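(* Let a planar $4$-web be given by differential $1$-forms $\omega_1,\omega_2,\omega_3,\omega_4$ normalized by $\omega_1+\omega_2+\omega_3=0$, $a\omega_1+\omega_2+\omega_4=0$, $d\omega_3=0$. There is a unique projective structure associated with the $4$-web in such a way that the $4$-web is geodesic with respect to this structure. This projective structure is the projective equivalence class of the torsion-free affine connection $\nabla$ with the following symmetric differential: $$d_\nabla^s(\omega_1)=\frac{z}{2}\,\omega_3\cdot\omega_1,\qquad d_\nabla^s(\omega_2)=-\frac{z}{2}\,\omega_3\cdot\omega_2,\qquad\text{where } z=\frac{a_1-aa_2}{a(1-a)}.$$
   Context: Everything is local, real and $C^\infty$. A planar $4$-web is a collection of four one-dimensional foliations of a plane domain whose directions are pairwise distinct at each point; the $i$-th foliation is given by $\omega_i=0$, and the forms can always be rescaled so as to satisfy the normalization in the claim, with a function $a\ne0,1$ (the basic invariant). Let $\partial_1,\partial_2$ be the frame dual to $\omega_1,\omega_2$; $a_i=\partial_i(a)$ for $i=1,2$. An affine connection $\nabla$ on the plane domain determines a covariant differential $d_\nabla:\Omega^1\to\Omega^1\otimes\Omega^1$, which splits as $d_\nabla=d_\nabla^a\oplus d_\nabla^s$ into its skew-symmetric part $d_\nabla^a:\Omega^1\to\Omega^2$ and its symmetric part $d_\nabla^s:\Omega^1\to S^2(\Omega^1)$. The connection is torsion-free if and only if $d_\nabla^a=d$, so a torsion-free connection is determined by $d_\nabla^s$; also $d^s_\nabla(f\omega)=df\cdot\omega+f\,d^s_\nabla(\omega)$, where the dot is the symmetric product, $\alpha\cdot\beta=\frac12(\alpha\otimes\beta+\beta\otimes\alpha)$.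 Two torsion-free affine connections are projectively equivalent if they have the same (unparametrized) geodesics; a projective structure is a projective equivalence class of torsion-free affine connections. A web is geodesic with respect to a connection (or its projective structure) if all leaves of all its foliations are (unparametrized) geodesics. *)

(* Defs.v *)
(* Stdlib reals with Coquelicot. *)
From Stdlib Require Import Reals List.
From Coquelicot Require Import Coquelicot.
Import ListNotations.
Open Scope R_scope.

Definition plane_domain (U : R * R -> Prop) : Prop :=
  open U /\ (exists p, U p) /\
  (forall V W : R * R -> Prop, open V -> open W ->
     (forall p, U p -> V p \/ W p) ->
     (exists p, U p /\ V p) -> (exists p, U p /\ W p) ->
     exists p, U p /\ V p /\ W p).

(* The two coordinate directions of the plane. Fields are given by their
   components in the standard coordinates; they are total functions of which
   only the values on the domain matter. *)
Inductive coord : Set := cx | cy.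

Definition sum2 (F : coord -> R) : R := F cx + F cy.

Definition scalar := R -> R -> R.
Definition vfield := coord -> scalar.
Definition form := coord -> scalar.            (* covariant components *)
Definition tensor := coord -> coord -> scalar. (* covariant components *)

Definition pd (i : coord) (f : scalar) : scalar :=
  match i with
  | cx => fun x y => Derive (fun t => f t y) x
  | cy => fun x y => Derive (fun t => f x t) y
  end.

(* [ex_diff_n f n x y]: [f] and its partial derivatives up to order [n] exist
   and are continuous. *)
Definition smooth (U : R * R -> Prop) (f : scalar) : Prop :=
  forall x y, U (x, y) -> forall n : nat, ex_diff_n f n x y.

Definition smooth_form (U : R * R -> Prop) (w : form) : Prop :=
  forall i, smooth U (w i).

Definition pairing (w : form) (v : vfield) : scalar :=
  fun x y => sum2 (fun k => w k x y * v k x y).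

Definition lie (v : vfield) (f : scalar) : scalar :=
  fun x y => sum2 (fun k => v k x y * pd k f x y).

Definition closed_form (U : R * R -> Prop) (w : form) : Prop :=
  forall x y, U (x, y) -> pd cx (w cy) x y - pd cy (w cx) x y = 0.

Definition sym_prod (u v : form) : tensor :=
  fun i j x y => (u i x y * v j x y + u j x y * v i x y) / 2.

Definition scale (f : scalar) (T : tensor) : tensor :=
  fun i j x y => f x y * T i j x y.

Definition tensor_eq_on (U : R * R -> Prop) (S T : tensor) : Prop :=
  forall i j x y, U (x, y) -> S i j x y = T i j x y.

(* An affine connection in coordinates: [G k i j] is the Christoffel symbol
   with nabla_{d_i} d_j = sum_k (G k i j) d_k. *)
Definition connection := coord -> coord -> coord -> scalar.

Definition torsion (G : connection) (k i j : coord) : scalar :=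
  fun x y => G k i j x y - G k j i x y.

Definition torsion_free_connection (U : R * R -> Prop) (G : connection) : Prop :=
  (forall k i j, smooth U (G k i j)) /\
  (forall k i j x y, U (x, y) -> torsion G k i j x y = 0).

Definition connection_eq_on (U : R * R -> Prop) (G H : connection) : Prop :=
  forall k i j x y, U (x, y) -> G k i j x y = H k i j x y.

(* Components (nabla_{d_i} w)(d_j). *)
Definition cov_diff (G : connection) (w : form) : tensor :=
  fun i j x y => pd i (w j) x y - sum2 (fun k => G k i j x y * w k x y).

Definition sym_diff (G : connection) (w : form) : tensor :=
  fun i j x y => (cov_diff G w i j x y + cov_diff G w j i x y) / 2.

Definition open_interval (I : R -> Prop) : Prop :=
  open I /\ (exists t, I t) /\
  (forall r s t, I r -> I t -> r <= s <= t -> I s).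

Definition smooth_on (I : R -> Prop) (f : R -> R) : Prop :=
  forall t, I t -> forall n : nat, ex_derive_n f n t.

Definition path := coord -> R -> R.

Definition regular_curve (U : R * R -> Prop) (I : R -> Prop) (c : path) : Prop :=
  open_interval I /\
  (forall i, smooth_on I (c i)) /\
  (forall t, I t -> U (c cx t, c cy t)) /\
  (forall t, I t -> exists i, Derive (c i) t <> 0).

Definition affine_geodesic (U : R * R -> Prop) (G : connection)
    (I : R -> Prop) (c : path) : Prop :=
  regular_curve U I c /\
  forall k t, I t ->
    Derive_n (c k) 2 t +
    sum2 (fun i => sum2 (fun j =>
      G k i j (c cx t) (c cy t) * Derive (c i) t * Derive (c j) t)) = 0.

(* A diffeomorphism from [J] onto [I]. *)
Definition reparametrization (J I : R -> Prop) (phi : R -> R) : Prop :=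
  open_interval J /\
  smooth_on J phi /\
  (forall s, J s -> I (phi s) /\ Derive phi s <> 0) /\
  (forall t, I t -> exists s, J s /\ phi s = t).

(* Unparametrized geodesic: some reparametrization solves the geodesic
   equation. *)
Definition geodesic (U : R * R -> Prop) (G : connection)
    (I : R -> Prop) (c : path) : Prop :=
  regular_curve U I c /\
  exists (J : R -> Prop) (phi : R -> R),
    reparametrization J I phi /\
    affine_geodesic U G J (fun i s => c i (phi s)).

Definition projectively_equivalent (U : R * R -> Prop) (G H : connection) : Prop :=
  forall (I : R -> Prop) (c : path), geodesic U G I c <-> geodesic U H I c.

Definition projective_class (U : R * R -> Prop) (G : connection)
    : connection -> Prop :=
  fun H => torsion_free_connection U H /\ projectively_equivalent U H G.

Definition projective_structure (U : R * R -> Prop) (P : connection -> Prop) : Prop :=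
  exists G, torsion_free_connection U G /\ P = projective_class U G.

Definition nonvanishing (U : R * R -> Prop) (w : form) : Prop :=
  forall x y, U (x, y) -> exists i, w i x y <> 0.

(* The lines ker u and ker v are distinct, i.e. meet only in 0. *)
Definition distinct_directions (U : R * R -> Prop) (u v : form) : Prop :=
  forall x y, U (x, y) -> forall X : coord -> R,
    sum2 (fun k => u k x y * X k) = 0 ->
    sum2 (fun k => v k x y * X k) = 0 -> forall k, X k = 0.

Definition web := list form.

Definition planar_web (U : R * R -> Prop) (W : web) : Prop :=
  List.Forall (smooth_form U) W /\ List.Forall (nonvanishing U) W /\
  ForallOrdPairs (distinct_directions U) W.

(* [c] parametrizes an open arc of a leaf of the foliation w = 0; whole leaves
   are covered too, as [I] may be the whole line and [c] periodic. *)
Definition leaf_curve (U : R * R -> Prop) (w : form)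
    (I : R -> Prop) (c : path) : Prop :=
  regular_curve U I c /\
  forall t, I t -> sum2 (fun k => w k (c cx t) (c cy t) * Derive (c k) t) = 0.

Definition geodesic_web (U : R * R -> Prop) (G : connection) (W : web) : Prop :=
  forall w, In w W -> forall (I : R -> Prop) (c : path),
    leaf_curve U w I c -> geodesic U G I c.

Definition geodesic_web_for (U : R * R -> Prop) (P : connection -> Prop)
    (W : web) : Prop :=
  forall G, P G -> geodesic_web U G W.

Definition dual_frame (U : R * R -> Prop) (w1 w2 : form) (e1 e2 : vfield) : Prop :=
  forall x y, U (x, y) ->
    pairing w1 e1 x y = 1 /\ pairing w1 e2 x y = 0 /\
    pairing w2 e1 x y = 0 /\ pairing w2 e2 x y = 1.

(* Main.v *)
(* A symmetric differential of w1 and w2 determines a torsion-free connection, by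
   Cramer's rule; a foliation [w = 0] is geodesic as soon as [d^s w] vanishes on
   its kernel, and for w4 this is what the choice of z achieves.  Conversely the
   projective class of G is the binary cubic form G(X,X) /\ X: through every
   point pass the leaves of the web, so any two connections with geodesic web have
   cubic forms agreeing in four distinct directions, hence everywhere.  Leaves
   exist by Picard iteration, and unparametrized geodesics are the curves with
   [c'' + G(c',c')] parallel to [c']. *)
Require Import Defs.
From Stdlib Require Import Reals List Lra Lia.
From Stdlib Require Import ClassicalEpsilon FunctionalExtensionality PropExtensionality.
From Coquelicot Require Import Coquelicot.
Import ListNotations.
(* [Reals] has its own [open_interval]. *)
Import Defs.
Open Scope R_scope.

(** Two definitions shape the proof: [geodesic] demands a smooth reparametrization onto the whole
    parameter interval, and smoothness means derivatives of every order. The first is traded for a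
    pointwise equation between [c'] and [c''], the second for closure rules under differentiation.
    In the pointwise equation [c''] enters in the same way for every connection. On a curve that is
    geodesic for one connection, being geodesic for another is therefore a condition on velocities
    alone, and each foliation has to supply only one velocity at each point: a short arc of leaf is
    enough. The number four matters because a nonzero binary cubic form vanishes on at most three
    lines. The prescribed differentials come from divisibility. For any function z, [d^s w1] is
    divisible by [w1], [d^s w2] by [w2], and the opposite signs make [d^s w3 = - d^s w1 - d^s w2]
    divisible by [w3], so three foliations are geodesic whatever z is. The fourth gives one linear
    equation for z, with the nonvanishing coefficient [a (1 - a)]. *)

(** * Smooth functions of one variable *)

(** Derivatives are peeled off from the inside and on all of [I] at once, so that the closure rules
    are plain inductions on the order; [ex_derive_n] peels them from the outside, at a single
    point. *)
Fixpoint diff_n (I : R -> Prop) (n : nat) (f : R -> R) : Prop :=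
  match n with
  | O => True
  | S m => (forall t, I t -> ex_derive f t) /\ diff_n I m (Derive f)
  end.

Lemma diff_n_ext (I : R -> Prop) (n : nat) (f g : R -> R) :
  open I -> (forall t, I t -> f t = g t) -> diff_n I n f -> diff_n I n g.
Proof.
  intros oI; revert f g; induction n as [|n IH]; intros f g e; [easy|].
  intros [d D]; split.
  - intros t ht; apply ex_derive_ext_loc with f; [|auto].
    apply filter_imp with (2 := oI t ht); auto.
  - apply IH with (2 := D); intros t ht; apply Derive_ext_loc.
    apply filter_imp with (2 := oI t ht); auto.
Qed.

(** The engine of the closure rules: on an open set [Derive f] may be replaced by any formula for
    the derivative, and the induction continues on that formula. *)
Lemma diff_n_intro (I : R -> Prop) (n : nat) (f g : R -> R) :
  open I -> (forall t, I t -> is_derive f t (g t)) -> diff_n I n g ->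
  diff_n I (S n) f.
Proof.
  intros oI d D; split.
  - intros t ht; exists (g t); auto.
  - apply diff_n_ext with g; auto.
    intros t ht; symmetry; apply is_derive_unique; auto.
Qed.

Lemma diff_n_is_derive (I : R -> Prop) (n : nat) (f : R -> R) (t : R) :
  diff_n I (S n) f -> I t -> is_derive f t (Derive f t).
Proof. intros [d _] ht; apply Derive_correct; auto. Qed.

Lemma diff_n_pred (I : R -> Prop) (n : nat) (f : R -> R) :
  diff_n I (S n) f -> diff_n I n f.
Proof.
  revert f; induction n as [|n IH]; intros f; [easy|].
  intros [d D]; split; auto.
Qed.

Lemma diff_n_const (I : R -> Prop) (n : nat) (a : R) :
  open I -> diff_n I n (fun _ => a).
Proof.
  intros oI; revert a; induction n as [|n IH]; intros a; [easy|].
  apply diff_n_intro with (fun _ => 0); auto.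
  intros t _; apply is_derive_Reals, derivable_pt_lim_const.
Qed.

Lemma diff_n_plus (I : R -> Prop) (n : nat) (f g : R -> R) :
  open I -> diff_n I n f -> diff_n I n g -> diff_n I n (fun t => f t + g t).
Proof.
  intros oI; revert f g; induction n as [|n IH]; intros f g Df Dg; [easy|].
  apply diff_n_intro with (fun t => Derive f t + Derive g t); auto.
  - intros t ht; apply (is_derive_plus (K := R_AbsRing) (V := R_NormedModule));
      eapply diff_n_is_derive; eauto.
  - apply IH; [apply Df | apply Dg].
Qed.

Lemma diff_n_mult (I : R -> Prop) (n : nat) (f g : R -> R) :
  open I -> diff_n I n f -> diff_n I n g -> diff_n I n (fun t => f t * g t).
Proof.
  intros oI; revert f g; induction n as [|n IH]; intros f g Df Dg; [easy|].
  apply diff_n_intro with (fun t => Derive f t * g t + f t * Derive g t); auto.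
  - intros t ht; apply (is_derive_mult (K := R_AbsRing) f g t);
      try (eapply diff_n_is_derive; eauto); apply Rmult_comm.
  - apply diff_n_plus; auto; apply IH;
      try apply Df; try apply Dg; apply diff_n_pred; auto.
Qed.

Lemma diff_n_inv (I : R -> Prop) (n : nat) (f : R -> R) :
  open I -> (forall t, I t -> f t <> 0) -> diff_n I n f ->
  diff_n I n (fun t => / f t).
Proof.
  intros oI nz; induction n as [|n IH]; intros Df; [easy|].
  (* The derivative is written as a product of factors [/ f], so that the product rule and the
     induction hypothesis apply to it. *)
  apply diff_n_intro with (fun t => -1 * (Derive f t * (/ f t * / f t))); auto.
  - intros t ht.
    replace (-1 * _) with (- Derive f t / f t ^ 2) by (field; auto).
    apply is_derive_inv; auto; eapply diff_n_is_derive; eauto.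
  - apply diff_n_mult; [auto | apply diff_n_const; auto |].
    apply diff_n_mult; [auto | apply Df |].
    apply diff_n_mult; auto; apply IH; apply diff_n_pred; auto.
Qed.

Lemma diff_n_comp (I J : R -> Prop) (n : nat) (f p : R -> R) :
  open J -> (forall t, J t -> I (p t)) ->
  diff_n I n f -> diff_n J n p -> diff_n J n (fun t => f (p t)).
Proof.
  intros oJ hp; revert f; induction n as [|n IH]; intros f Df Dp; [easy|].
  apply diff_n_intro with (fun t => Derive p t * Derive f (p t)); auto.
  - intros t ht; apply (is_derive_comp (K := R_AbsRing) (V := R_NormedModule));
      eapply diff_n_is_derive; eauto.
  - apply diff_n_mult; [auto | apply Dp |].
    apply IH; [apply Df | apply diff_n_pred; auto].
Qed.

Lemma diff_n_exp (I : R -> Prop) (n : nat) (f : R -> R) :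
  open I -> diff_n I n f -> diff_n I n (fun t => exp (f t)).
Proof.
  intros oI; induction n as [|n IH]; intros Df; [easy|].
  apply diff_n_intro with (fun t => Derive f t * exp (f t)); auto.
  - intros t ht; apply (is_derive_comp (K := R_AbsRing) (V := R_NormedModule)).
    + apply is_derive_exp.
    + eapply diff_n_is_derive; eauto.
  - apply diff_n_mult; [auto | apply Df | apply IH; apply diff_n_pred; auto].
Qed.

(** [Derive_n_comp] exchanges the innermost derivative with the outermost one. All orders up to n
    are carried together, because [diff_n] at order n contains the lower orders. *)
Lemma smooth_on_diff_n (I : R -> Prop) (f : R -> R) :
  smooth_on I f <-> forall n, diff_n I n f.
Proof.
  assert (E : forall n g, (forall t, I t -> forall k, (k <= n)%nat -> ex_derive_n g k t)
            <-> diff_n I n g).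
  { induction n as [|n IH]; intros g.
    - split; [easy|]. intros _ t ht k hk; replace k with O by lia; exact Logic.I.
    - split.
      + intros h; split.
        * intros t ht; apply (h t ht 1%nat); lia.
        * apply IH; intros t ht k hk.
          destruct k as [|k]; [exact Logic.I|].
          apply ex_derive_ext with (Derive_n g (S k)).
          -- intros s; rewrite <- (Nat.add_1_r k); symmetry.
             apply (Derive_n_comp g k 1).
          -- apply (h t ht (S (S k))); lia.
      + intros [d D] t ht k hk.
        destruct k as [|[|k]]; [exact Logic.I | apply d; auto |].
        apply ex_derive_ext with (Derive_n (Derive g) k).
        * intros s; rewrite <- (Nat.add_1_r k); apply (Derive_n_comp g k 1).
        * apply (proj2 (IH (Derive g)) D t ht (S k)); lia. }
  split.
  - intros h n; apply E; intros t ht k _; apply h; auto.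
  - intros h t ht n; apply (proj2 (E n f) (h n) t ht); auto.
Qed.

(** * Smooth functions of two variables *)

Lemma smooth_pd (U : R * R -> Prop) (f : scalar) (i : coord) :
  smooth U f -> smooth U (pd i f).
Proof.
  intros h x y hU n; specialize (h x y hU (S n)).
  destruct h as (_ & _ & _ & h1 & h2); destruct i; auto.
Qed.

Lemma smooth_continuity (U : R * R -> Prop) (f : scalar) (x y : R) :
  smooth U f -> U (x, y) -> continuity_2d_pt f x y.
Proof. intros h hU; apply (h x y hU O). Qed.

Lemma smooth_derive_x (U : R * R -> Prop) (f : scalar) (x y : R) :
  smooth U f -> U (x, y) -> is_derive (fun t => f t y) x (pd cx f x y).
Proof. intros h hU; apply Derive_correct, (h x y hU 1%nat). Qed.

Lemma smooth_derive_y (U : R * R -> Prop) (f : scalar) (x y : R) :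
  smooth U f -> U (x, y) -> is_derive (fun t => f x t) y (pd cy f x y).
Proof. intros h hU; apply Derive_correct, (h x y hU 1%nat). Qed.

Lemma open_locally_2d (U : R * R -> Prop) (x y : R) :
  open U -> U (x, y) -> locally_2d (fun u v => U (u, v)) x y.
Proof.
  intros oU hU; apply locally_2d_locally.
  apply filter_imp with (2 := oU _ hU); intros [u v]; auto.
Qed.

(* Proved smooth all at once, the algebra being closed under [pd]. *)
Inductive smooth_algebra (U : R * R -> Prop) : scalar -> Prop :=
| sa_base f : smooth U f -> smooth_algebra U f
| sa_const a : smooth_algebra U (fun _ _ => a)
| sa_plus f g : smooth_algebra U f -> smooth_algebra U g ->
    smooth_algebra U (fun x y => f x y + g x y)
| sa_mult f g : smooth_algebra U f -> smooth_algebra U g ->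
    smooth_algebra U (fun x y => f x y * g x y)
| sa_inv f : smooth_algebra U f -> (forall x y, U (x, y) -> f x y <> 0) ->
    smooth_algebra U (fun x y => / f x y)
| sa_ext f g : smooth_algebra U f -> (forall x y, U (x, y) -> f x y = g x y) ->
    smooth_algebra U g.

(** The conclusion collects what one level of [ex_diff_n] asks: continuity, both partial
    derivatives, and partial derivatives that lie in the same class, so that the next level can be
    treated alike. *)
Lemma smooth_algebra_pd (U : R * R -> Prop) (f : scalar) :
  open U -> smooth_algebra U f ->
  (forall x y, U (x, y) ->
     continuity_2d_pt f x y /\
     is_derive (fun t => f t y) x (pd cx f x y) /\
     is_derive (fun t => f x t) y (pd cy f x y)) /\
  smooth_algebra U (pd cx f) /\ smooth_algebra U (pd cy f).
Proof.
  intros oU; induction 1 as [f sf | a | f g sf IHf sg IHg | f g sf IHf sg IHg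
    | f sf IHf nz | f g sf IHf e].
  - split; [|split; apply sa_base, smooth_pd; auto].
    intros x y hU; split; [|split];
      [eapply smooth_continuity | eapply smooth_derive_x | eapply smooth_derive_y]; eauto.
  - assert (E : forall i x y, pd i (fun _ _ => a) x y = 0)
      by (intros [|] x y; apply (Derive_const a)).
    split.
    + intros x y _; rewrite !E; split; [apply continuity_2d_pt_const|].
      split; apply is_derive_Reals, derivable_pt_lim_const.
    + split; apply sa_ext with (fun _ _ => 0); auto; apply sa_const.
  - destruct IHf as (Df & Xf & Yf), IHg as (Dg & Xg & Yg).
    assert (D : forall x y, U (x, y) ->
      is_derive (fun t => f t y + g t y) x (pd cx f x y + pd cx g x y) /\
      is_derive (fun t => f x t + g x t) y (pd cy f x y + pd cy g x y)).
    { intros x y hU; split; apply (is_derive_plus (K := R_AbsRing) (V := R_NormedModule));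
        try apply Df; try apply Dg; auto. }
    split; [|split].
    + intros x y hU; destruct (D x y hU) as [d1 d2]; split; [|split].
      * apply continuity_2d_pt_plus; [apply Df | apply Dg]; auto.
      * apply Derive_correct; eexists; eauto.
      * apply Derive_correct; eexists; eauto.
    + apply sa_ext with (fun x y => pd cx f x y + pd cx g x y); [apply sa_plus; auto|].
      intros x y hU; symmetry; apply is_derive_unique, D, hU.
    + apply sa_ext with (fun x y => pd cy f x y + pd cy g x y); [apply sa_plus; auto|].
      intros x y hU; symmetry; apply is_derive_unique, D, hU.
  - destruct IHf as (Df & Xf & Yf), IHg as (Dg & Xg & Yg).
    assert (D : forall x y, U (x, y) ->
      is_derive (fun t => f t y * g t y) x (pd cx f x y * g x y + f x y * pd cx g x y) /\
      is_derive (fun t => f x t * g x t) y (pd cy f x y * g x y + f x y * pd cy g x y)).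
    { intros x y hU; split;
        [apply (is_derive_mult (K := R_AbsRing) (fun t => f t y) (fun t => g t y))
        |apply (is_derive_mult (K := R_AbsRing) (fun t => f x t) (fun t => g x t))];
        try apply Df; try apply Dg; auto; apply Rmult_comm. }
    split; [|split].
    + intros x y hU; destruct (D x y hU) as [d1 d2]; split; [|split].
      * apply continuity_2d_pt_mult; [apply Df | apply Dg]; auto.
      * apply Derive_correct; eexists; eauto.
      * apply Derive_correct; eexists; eauto.
    + apply sa_ext with (fun x y => pd cx f x y * g x y + f x y * pd cx g x y);
        [apply sa_plus; apply sa_mult; auto|].
      intros x y hU; symmetry; apply is_derive_unique, D, hU.
    + apply sa_ext with (fun x y => pd cy f x y * g x y + f x y * pd cy g x y);
        [apply sa_plus; apply sa_mult; auto|].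
      intros x y hU; symmetry; apply is_derive_unique, D, hU.
  - destruct IHf as (Df & Xf & Yf).
    assert (D : forall x y, U (x, y) ->
      is_derive (fun t => / f t y) x (-1 * (pd cx f x y * (/ f x y * / f x y))) /\
      is_derive (fun t => / f x t) y (-1 * (pd cy f x y * (/ f x y * / f x y)))).
    { intros x y hU; split.
      - replace (-1 * _) with (- pd cx f x y / f x y ^ 2) by (field; auto).
        apply (is_derive_inv (fun t => f t y)); auto; apply Df; auto.
      - replace (-1 * _) with (- pd cy f x y / f x y ^ 2) by (field; auto).
        apply (is_derive_inv (fun t => f x t)); auto; apply Df; auto. }
    split; [|split].
    + intros x y hU; destruct (D x y hU) as [d1 d2]; split; [|split].
      * apply continuity_2d_pt_inv; auto; apply Df; auto.
      * apply Derive_correct; eexists; eauto.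
      * apply Derive_correct; eexists; eauto.
    + eapply sa_ext with (fun x y => -1 * (pd cx f x y * (/ f x y * / f x y))).
      * repeat apply sa_mult; auto using sa_const, sa_inv.
      * intros x y hU; symmetry; apply is_derive_unique, D, hU.
    + eapply sa_ext with (fun x y => -1 * (pd cy f x y * (/ f x y * / f x y))).
      * repeat apply sa_mult; auto using sa_const, sa_inv.
      * intros x y hU; symmetry; apply is_derive_unique, D, hU.
  - destruct IHf as (Df & Xf & Yf).
    (* Equality on the open set [U] is equality near each of its points, hence passes to
       derivatives. *)
    assert (L : forall x y, U (x, y) -> locally_2d (fun u v => f u v = g u v) x y).
    { intros x y hU; apply locally_2d_impl with (2 := open_locally_2d U x y oU hU).
      apply locally_2d_forall; auto. }
    assert (D : forall x y, U (x, y) ->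
      is_derive (fun t => g t y) x (pd cx f x y) /\
      is_derive (fun t => g x t) y (pd cy f x y)).
    { intros x y hU; split.
      - apply is_derive_ext_loc with (fun t => f t y); [|apply Df; auto].
        exact (locally_2d_1d_const_y _ x y (L x y hU)).
      - apply is_derive_ext_loc with (fun t => f x t); [|apply Df; auto].
        exact (locally_2d_1d_const_x _ x y (L x y hU)). }
    split; [|split].
    + intros x y hU; destruct (D x y hU) as [d1 d2]; split; [|split].
      * apply continuity_2d_pt_ext_loc with f; auto; apply Df; auto.
      * apply Derive_correct; eexists; eauto.
      * apply Derive_correct; eexists; eauto.
    + apply sa_ext with (pd cx f); auto.
      intros x y hU; symmetry; apply is_derive_unique, D, hU.
    + apply sa_ext with (pd cy f); auto.
      intros x y hU; symmetry; apply is_derive_unique, D, hU.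
Qed.

Lemma smooth_algebra_smooth (U : R * R -> Prop) (f : scalar) :
  open U -> smooth_algebra U f -> smooth U f.
Proof.
  intros oU sf x y hU n; revert f sf; induction n as [|n IH]; intros f sf;
    destruct (smooth_algebra_pd U f oU sf) as (D & X & Y);
    destruct (D x y hU) as (c & dx & dy).
  - split; auto.
  - split; [auto|]. split; [eexists; eauto|]. split; [eexists; eauto|].
    split; [apply (IH (pd cx f)) | apply (IH (pd cy f))]; auto.
Qed.

(** Joint differentiability at the point follows from the x-derivative existing nearby and being
    continuous, together with the y-derivative at the point. *)
Lemma smooth_chain (U : R * R -> Prop) (f : scalar) (u v : R -> R) (t u' v' : R) :
  open U -> smooth U f -> U (u t, v t) -> is_derive u t u' -> is_derive v t v' ->
  is_derive (fun s => f (u s) (v s)) t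
    (pd cx f (u t) (v t) * u' + pd cy f (u t) (v t) * v').
Proof.
  intros oU sf hU du dv; apply is_derive_Reals.
  apply derivable_pt_lim_comp_2d; [|apply is_derive_Reals; auto..].
  apply filterdiff_differentiable_pt_lim.
  apply (is_derive_filterdiff f (u t) (v t) (pd cx f) (pd cy f (u t) (v t))).
  - apply filter_imp with (2 := oU _ hU); intros [a b] h; eapply smooth_derive_x; eauto.
  - apply (smooth_derive_y U f); auto.
  - apply continuity_2d_pt_filterlim; apply (smooth_continuity U); auto.
    apply smooth_pd; auto.
Qed.

Lemma diff_n_chain (U : R * R -> Prop) (I : R -> Prop) (n : nat) (f : scalar)
    (u v : R -> R) :
  open U -> open I -> smooth U f -> (forall t, I t -> U (u t, v t)) ->
  diff_n I n u -> diff_n I n v -> diff_n I n (fun t => f (u t) (v t)).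
Proof.
  intros oU oI sf hU; revert f sf; induction n as [|n IH]; intros f sf Du Dv; [easy|].
  apply diff_n_intro with
    (fun t => pd cx f (u t) (v t) * Derive u t + pd cy f (u t) (v t) * Derive v t); auto.
  - intros t ht; eapply smooth_chain; eauto; eapply diff_n_is_derive; eauto.
  - apply diff_n_plus; auto; apply diff_n_mult; auto;
      try apply Du; try apply Dv; apply IH; auto using smooth_pd, diff_n_pred.
Qed.

(** * Geodesics up to reparametrization *)

Lemma primitive_exists (I : R -> Prop) (f : R -> R) :
  open_interval I -> (forall t, I t -> continuous f t) ->
  exists F, forall t, I t -> is_derive F t (f t).
Proof.
  intros (oI & [t0 h0] & cv) cf; exists (fun t => RInt f t0 t); intros t ht.
  apply (is_derive_RInt (V := R_NormedModule) f (fun t => RInt f t0 t) t0); auto.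
  apply filter_imp with (2 := oI t ht); intros s hs.
  apply (RInt_correct (V := R_CompleteNormedModule)).
  apply (ex_RInt_continuous (V := R_CompleteNormedModule)); intros r hr; apply cf.
  destruct (Rle_dec t0 s);
    [rewrite Rmin_left, Rmax_right in hr by lra; apply (cv t0 r s)
    |rewrite Rmin_right, Rmax_left in hr by lra; apply (cv s r t0)]; auto; lra.
Qed.

Lemma is_derive_continuous (f : R -> R) (t l : R) : is_derive f t l -> continuous f t.
Proof.
  intros d; apply (ex_derive_continuous (K := R_AbsRing) (V := R_NormedModule)).
  exists l; auto.
Qed.

Lemma MVT_interval (I : R -> Prop) (f df : R -> R) (a b : R) :
  open_interval I -> (forall t, I t -> is_derive f t (df t)) -> I a -> I b ->
  exists c, I c /\ Rmin a b <= c <= Rmax a b /\ f b - f a = df c * (b - a).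
Proof.
  intros (oI & _ & cv) d ha hb.
  assert (K : forall r, Rmin a b <= r <= Rmax a b -> I r).
  { intros r hr; destruct (Rle_dec a b);
    [rewrite Rmin_left, Rmax_right in hr by lra; apply (cv a r b)
    |rewrite Rmin_right, Rmax_left in hr by lra; apply (cv b r a)]; auto; lra. }
  destruct (MVT_gen f a b df) as (c & hc & e).
  - intros x hx; apply d, K; lra.
  - intros x hx; apply continuity_pt_filterlim.
    apply is_derive_continuous with (df x); apply d, K; auto.
  - exists c; auto.
Qed.

(** A positive derivative makes [f] strictly increasing, and the intermediate value theorem then
    makes the image an open interval. The inverse is differentiable because, by the mean value
    theorem, its difference quotients are values of [/ q] at nearby points. *)
Lemma inverse_function (I : R -> Prop) (f q : R -> R) :
  open_interval I -> (forall t, I t -> is_derive f t (q t)) ->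
  (forall t, I t -> 0 < q t) -> (forall t, I t -> continuous q t) ->
  let J := fun s => exists t, I t /\ f t = s in
  exists g, open_interval J /\
    (forall s, J s -> I (g s) /\ is_derive g s (/ q (g s))) /\
    (forall t, I t -> g (f t) = t).
Proof.
  intros OI d pos cq J; destruct (OI) as (oI & [t0 h0] & cv).
  assert (mono : forall a b, I a -> I b -> a < b -> f a < f b).
  { intros a b ha hb ab.
    destruct (MVT_interval I f q a b OI d ha hb) as (c & hc & _ & e).
    assert (0 < q c * (b - a)) by (apply Rmult_lt_0_compat; [auto | lra]); lra. }
  assert (mono' : forall a b, I a -> I b -> f a < f b -> a < b).
  { intros a b ha hb ab; destruct (Rtotal_order a b) as [h | [-> | h]]; auto; [lra|].
    specialize (mono b a hb ha h); lra. }
  assert (ivt : forall a b s, I a -> I b -> f a <= s <= f b -> J s).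
  { intros a b s ha hb hs.
    destruct (Req_dec (f a) (f b)) as [e | n]; [exists a; split; auto; lra|].
    assert (ab : a < b) by (apply mono'; auto; lra).
    destruct (Ranalysis5.f_interv_is_interv f a b s) as (c & hc & e); auto.
    - intros r hr; apply continuity_pt_filterlim, is_derive_continuous with (q r), d.
      apply (cv a r b); auto.
    - exists c; split; auto; apply (cv a c b); auto. }
  (* Outside [J] the chosen value is arbitrary; all later claims about [g] are restricted to [J]. *)
  set (g := fun s => epsilon (inhabits 0) (fun t => I t /\ f t = s)).
  assert (gs : forall s, J s -> I (g s) /\ f (g s) = s)
    by (intros s hs; exact (epsilon_spec (inhabits 0) (fun t => I t /\ f t = s) hs)).
  assert (near : forall t (P : R -> Prop), I t -> locally t P ->
    exists e, 0 < e /\ forall r, Rabs (r - t) <= e -> I r /\ P r).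
  { intros t P ht hP.
    destruct (filter_and _ _ (oI t ht) hP) as [e he].
    exists (e / 2); split; [destruct e; simpl; lra|].
    intros r hr; apply he; change (Rabs (r - t) < e); destruct e; simpl in *; lra. }
  exists g; split; [split; [|split] | split].
  - intros s (t & ht & <-).
    destruct (near t (fun _ => True) ht) as (e & he & hI); [apply filter_true|].
    assert (h1 : I (t - e)) by (apply hI; rewrite Rabs_left; lra).
    assert (h2 : I (t + e)) by (apply hI; rewrite Rabs_right; lra).
    assert (f (t - e) < f t) by (apply mono; auto; lra).
    assert (f t < f (t + e)) by (apply mono; auto; lra).
    assert (m : 0 < Rmin (f t - f (t - e)) (f (t + e) - f t))
      by (apply Rmin_pos; lra).
    exists (mkposreal _ m); intros r hr; change (Rabs (r - f t) <
      Rmin (f t - f (t - e)) (f (t + e) - f t)) in hr.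
    pose proof (Rmin_l (f t - f (t - e)) (f (t + e) - f t)).
    pose proof (Rmin_r (f t - f (t - e)) (f (t + e) - f t)).
    apply Rabs_def2 in hr; apply (ivt (t - e) (t + e)); auto; lra.
  - exists (f t0), t0; auto.
  - intros r s t (a & ha & <-) (b & hb & <-) h; apply (ivt a b); auto.
  - intros s hs; destruct (gs s hs) as [hI e0]; split; auto.
    assert (ci : continuous (fun r => / q r) (g s)).
    { apply continuous_comp with (g := Rinv); auto.
      apply continuity_pt_filterlim, derivable_continuous_pt, derivable_pt_inv;
        [specialize (pos _ hI); unfold id; lra | apply derivable_pt_id]. }
    apply is_derive_Reals; intros eps heps.
    destruct (near (g s) _ hI (ci _ (locally_ball _ (mkposreal eps heps))))
      as (e & he & H).
    assert (h1 : I (g s - e)) by (apply H; rewrite Rabs_left; lra).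
    assert (h2 : I (g s + e)) by (apply H; rewrite Rabs_right; lra).
    assert (f (g s - e) < s) by (rewrite <- e0; rewrite e0 at 1; apply mono; auto; lra).
    assert (s < f (g s + e)) by (rewrite <- e0; rewrite e0 at 2; apply mono; auto; lra).
    (* Within this radius [s + h] lies between the values of [f] at [g s - e] and [g s + e], so
       [g (s + h)] stays within [e] of [g s]. *)
    assert (m : 0 < Rmin (s - f (g s - e)) (f (g s + e) - s))
      by (apply Rmin_pos; lra).
    exists (mkposreal _ m); intros h hn hh; simpl in hh.
    pose proof (Rmin_l (s - f (g s - e)) (f (g s + e) - s)).
    pose proof (Rmin_r (s - f (g s - e)) (f (g s + e) - s)).
    apply Rabs_def2 in hh.
    assert (hJ : J (s + h)) by (apply (ivt (g s - e) (g s + e)); auto; lra).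
    destruct (gs _ hJ) as [hI' e'].
    assert (g s - e < g (s + h)) by (apply mono'; auto; lra).
    assert (g (s + h) < g s + e) by (apply mono'; auto; lra).
    destruct (MVT_interval I f q (g s) (g (s + h)) OI d hI hI') as (c & hc & hb & E).
    assert (hce : Rabs (c - g s) <= e).
    { revert hb; unfold Rmin, Rmax; destruct Rle_dec; intros; apply Rabs_le; lra. }
    specialize (pos c hc).
    assert (E2 : (g (s + h) - g s) / h = / q c).
    { assert (h = q c * (g (s + h) - g s)) as E3 by lra.
      assert (g (s + h) - g s <> 0) by (intros z; rewrite z in E3; lra).
      rewrite E3 at 2; field; split; auto; lra. }
    rewrite E2; destruct (H c hce) as [_ B]; exact B.
  - intros t ht; destruct (gs (f t)) as [hI e]; [exists t; auto|].
    destruct (Rtotal_order (g (f t)) t) as [h | [h | h]]; auto.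
    + specialize (mono _ _ hI ht h); lra.
    + specialize (mono _ _ ht hI h); lra.
Qed.

Definition acceleration (G : connection) (c : path) (k : coord) (t : R) : R :=
  Derive_n (c k) 2 t +
  sum2 (fun i => sum2 (fun j =>
    G k i j (c cx t) (c cy t) * Derive (c i) t * Derive (c j) t)).

Lemma derive_reparametrized (I J : R -> Prop) (c p : R -> R) (s : R) :
  open J -> smooth_on I c -> smooth_on J p -> (forall r, J r -> I (p r)) -> J s ->
  Derive (fun r => c (p r)) s = Derive p s * Derive c (p s) /\
  Derive_n (fun r => c (p r)) 2 s =
    Derive_n p 2 s * Derive c (p s) + Derive p s ^ 2 * Derive_n c 2 (p s).
Proof.
  intros oJ sc sp hp hs.
  assert (sc' := proj1 (smooth_on_diff_n I c) sc 2%nat).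
  assert (sp' := proj1 (smooth_on_diff_n J p) sp 2%nat).
  assert (D : forall r, J r -> Derive (fun r => c (p r)) r = Derive p r * Derive c (p r)).
  { intros r hr; apply is_derive_unique.
    apply (is_derive_comp (K := R_AbsRing) (V := R_NormedModule));
      eapply diff_n_is_derive; eauto. }
  split; auto.
  change (Derive (Derive (fun r => c (p r))) s =
    Derive (Derive p) s * Derive c (p s) + Derive p s ^ 2 * Derive (Derive c) (p s)).
  rewrite (Derive_ext_loc _ (fun r => Derive p r * Derive c (p r)))
    by (apply filter_imp with (2 := oJ s hs); auto).
  apply is_derive_unique.
  destruct sc' as [_ dc], sp' as [dp dp'].
  replace (_ + _) with (Derive (Derive p) s * Derive c (p s) +
    Derive p s * (Derive p s * Derive (Derive c) (p s))) by ring.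
  apply (is_derive_mult (K := R_AbsRing) (Derive p) (fun r => Derive c (p r)));
    [eapply diff_n_is_derive; eauto | | apply Rmult_comm].
  apply (is_derive_comp (K := R_AbsRing) (V := R_NormedModule));
    [eapply diff_n_is_derive; eauto | apply Derive_correct; auto].
Qed.

(** The Christoffel term scales by [p'^2] exactly as [c''] does; the only new contribution,
    [p'' c'], is tangential. *)
Lemma acceleration_reparametrized (I J : R -> Prop) (G : connection) (c : path)
    (p : R -> R) (k : coord) (s : R) :
  open J -> (forall i, smooth_on I (c i)) -> smooth_on J p ->
  (forall r, J r -> I (p r)) -> J s ->
  acceleration G (fun i r => c i (p r)) k s =
    Derive_n p 2 s * Derive (c k) (p s) + Derive p s ^ 2 * acceleration G c k (p s).
Proof.
  intros oJ sc sp hp hs; unfold acceleration, sum2.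
  destruct (derive_reparametrized I J (c k) p s oJ (sc k) sp hp hs) as [_ ->].
  destruct (derive_reparametrized I J (c cx) p s oJ (sc cx) sp hp hs) as [-> _].
  destruct (derive_reparametrized I J (c cy) p s oJ (sc cy) sp hp hs) as [-> _].
  ring.
Qed.

Lemma smooth_on_continuous (I : R -> Prop) (f : R -> R) (t : R) :
  smooth_on I f -> I t -> continuous f t.
Proof.
  intros sf ht; apply is_derive_continuous with (Derive f t).
  apply Derive_correct, (sf t ht 1%nat).
Qed.

Lemma smooth_on_derive (I : R -> Prop) (f df : R -> R) :
  open I -> (forall t, I t -> is_derive f t (df t)) -> smooth_on I df -> smooth_on I f.
Proof.
  intros oI d s; apply smooth_on_diff_n; intros n; apply diff_n_pred.
  apply diff_n_intro with df; auto; apply smooth_on_diff_n; auto.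
Qed.

(* Reparametrizing by [p] turns the acceleration [f c'] into
   [(p'' + f(p) p'^2) c'(p)]; the inverse of the integral of [exp F], where
   [F' = f], makes it vanish. *)
Lemma geodesic_iff (U : R * R -> Prop) (G : connection) (I : R -> Prop) (c : path) :
  open U -> (forall k i j, smooth U (G k i j)) ->
  geodesic U G I c <-> regular_curve U I c /\ forall t, I t ->
    acceleration G c cx t * Derive (c cy) t = acceleration G c cy t * Derive (c cx) t.
Proof.
  intros oU sG; split.
  - intros (rc & J & p & ((oJ & _ & _) & sp & hp & onto) & _ & ag); split; auto.
    intros t ht; destruct (onto t ht) as (s & hs & <-).
    destruct (hp s hs) as [_ nz]; destruct rc as (_ & sc & _).
    assert (hpI : forall r, J r -> I (p r)) by (intros r hr; apply hp; auto).
    assert (ex := ag cx s hs); assert (ey := ag cy s hs).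
    fold (acceleration G (fun i r => c i (p r)) cx s) in ex.
    fold (acceleration G (fun i r => c i (p r)) cy s) in ey.
    rewrite (acceleration_reparametrized I J) in ex, ey by auto.
    apply Rmult_eq_reg_l with (Derive p s ^ 2); [|apply pow_nonzero; auto].
    transitivity (- Derive_n p 2 s * Derive (c cx) (p s) * Derive (c cy) (p s)).
    + replace (Derive p s ^ 2 * _) with
        (Derive p s ^ 2 * acceleration G c cx (p s) * Derive (c cy) (p s)) by ring.
      replace (Derive p s ^ 2 * acceleration G c cx (p s)) with
        (- Derive_n p 2 s * Derive (c cx) (p s)) by lra; ring.
    + replace (Derive p s ^ 2 * _) with
        (Derive p s ^ 2 * acceleration G c cy (p s) * Derive (c cx) (p s)) by ring.
      replace (Derive p s ^ 2 * acceleration G c cy (p s)) with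
        (- Derive_n p 2 s * Derive (c cy) (p s)) by lra; ring.
  - intros [rc col]; split; auto.
    destruct (rc) as (OI & sc & hU & reg); destruct (OI) as (oI & _ & _).
    set (n2 := fun t => Derive (c cx) t * Derive (c cx) t + Derive (c cy) t * Derive (c cy) t).
    assert (n2pos : forall t, I t -> n2 t <> 0).
    { intros t ht; unfold n2; destruct (reg t ht) as [[|] h]; nra. }
    (* The coefficient in [acceleration = f c'] is obtained by Euclidean projection onto [c']: a
       quotient by a component of [c'] would be smooth only where that component is nonzero. *)
    set (f := fun t => (acceleration G c cx t * Derive (c cx) t +
                        acceleration G c cy t * Derive (c cy) t) * / n2 t).
    assert (hf : forall k t, I t -> acceleration G c k t = f t * Derive (c k) t).
    { intros k t ht; specialize (col t ht); specialize (n2pos t ht).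
      unfold f; apply Rmult_eq_reg_r with (n2 t); auto.
      replace (_ * / n2 t * _ * n2 t) with ((acceleration G c cx t * Derive (c cx) t +
        acceleration G c cy t * Derive (c cy) t) * Derive (c k) t) by (field; auto).
      unfold n2; destruct k.
      - transitivity (acceleration G c cx t * Derive (c cx) t * Derive (c cx) t +
          (acceleration G c cx t * Derive (c cy) t) * Derive (c cy) t); [ring|].
        rewrite col; ring.
      - transitivity ((acceleration G c cy t * Derive (c cx) t) * Derive (c cx) t +
          acceleration G c cy t * Derive (c cy) t * Derive (c cy) t); [ring|].
        rewrite <- col; ring. }
    assert (dc : forall k n, diff_n I n (c k)) by (intros k; apply smooth_on_diff_n; auto).
    assert (dc' : forall k n, diff_n I n (Derive (c k))) by (intros k n; apply (dc k (S n))).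
    assert (dc'' : forall k n, diff_n I n (Derive (Derive (c k))))
      by (intros k n; apply (dc k (S (S n)))).
    assert (da : forall k n, diff_n I n (acceleration G c k)).
    { intros k n; unfold acceleration, sum2.
      repeat apply diff_n_plus; repeat apply diff_n_mult; auto; try apply dc'';
        apply diff_n_chain with U; auto. }
    assert (sf : smooth_on I f).
    { apply smooth_on_diff_n; intros n; unfold f.
      apply diff_n_mult; auto; [apply diff_n_plus; auto; apply diff_n_mult; auto|].
      apply diff_n_inv; auto; unfold n2; apply diff_n_plus; auto; apply diff_n_mult; auto. }
    destruct (primitive_exists I f OI) as [F dF];
      [intros t ht; apply smooth_on_continuous with I; auto|].
    assert (sF : smooth_on I F) by (apply smooth_on_derive with f; auto).
    set (q := fun t => exp (F t)).
    assert (sq : smooth_on I q).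
    { apply smooth_on_diff_n; intros n; apply diff_n_exp; auto; apply smooth_on_diff_n; auto. }
    assert (qpos : forall t, 0 < q t) by (intros t; apply exp_pos).
    assert (cq : forall t, I t -> continuous q t)
      by (intros t ht; apply smooth_on_continuous with I; auto).
    destruct (primitive_exists I q OI cq) as [P dP].
    destruct (inverse_function I P q OI dP) as (p & OJ & dp & onto); auto.
    set (J := fun s => exists t, I t /\ P t = s) in *.
    destruct (OJ) as (oJ & _ & _).
    assert (hp : forall s, J s -> I (p s)) by (intros s hs; apply dp; auto).
    assert (dp1 : forall s, J s -> Derive p s = / q (p s))
      by (intros s hs; apply is_derive_unique, dp; auto).
    (* Bootstrap: [p' = 1 / q(p)] with [q] smooth and positive, so n derivatives of [p] yield one
       more. *)
    assert (sp : smooth_on J p).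
    { apply smooth_on_diff_n; induction n as [|n IH]; [easy|].
      apply diff_n_intro with (fun s => / q (p s)); auto; [intros s hs; apply dp; auto|].
      apply (diff_n_comp I J n (fun t => / q t)); auto.
      apply diff_n_inv; auto; [|apply smooth_on_diff_n; auto].
      intros t _; specialize (qpos t); lra. }
    (* As [q' = f q], differentiating [p' = 1 / q(p)] produces exactly the [p''] that cancels the
       acceleration. *)
    assert (dp2 : forall s, J s -> Derive_n p 2 s = - f (p s) * Derive p s ^ 2).
    { intros s hs; simpl.
      rewrite (Derive_ext_loc _ (fun s => / q (p s)))
        by (apply filter_imp with (2 := oJ s hs); auto).
      apply is_derive_unique.
      replace (- f (p s) * _) with
        (- (Derive p s * (f (p s) * q (p s))) / q (p s) ^ 2)
        by (rewrite dp1 by auto; field; specialize (qpos (p s)); lra).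
      apply (is_derive_inv (fun s => q (p s))); [|specialize (qpos (p s)); lra].
      apply (is_derive_comp (K := R_AbsRing) (V := R_NormedModule) q p);
        [|apply Derive_correct, (sp s hs 1%nat)].
      apply (is_derive_comp (K := R_AbsRing) (V := R_NormedModule) exp F (p s));
        [apply is_derive_exp | apply dF; auto]. }
    assert (nz : forall s, J s -> Derive p s <> 0).
    { intros s hs; rewrite dp1 by auto; apply Rinv_neq_0_compat.
      specialize (qpos (p s)); lra. }
    exists J, p; split; [|split].
    + split; [auto|]; split; [auto|]; split; [auto|].
      intros t ht; exists (P t); split; [exists t; auto | auto].
    + split; [auto|]; split; [|split].
      * intros i; apply smooth_on_diff_n; intros n; apply diff_n_comp with I; auto.
        apply smooth_on_diff_n; auto.
      * intros s hs; auto.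
      * intros s hs; destruct (reg (p s) (hp s hs)) as [i hi]; exists i.
        destruct (derive_reparametrized I J (c i) p s) as [-> _]; auto.
    + intros k s hs; change (acceleration G (fun i s => c i (p s)) k s = 0).
      rewrite (acceleration_reparametrized I J) by auto.
      rewrite dp2, hf by auto; ring.
Qed.

(** * Integral curves of smooth vector fields *)

Lemma open_interval_ball (a d : R) : 0 < d -> open_interval (fun s => Rabs (s - a) < d).
Proof.
  intros hd; split; [|split].
  - intros s hs; assert (m : 0 < d - Rabs (s - a)) by lra.
    exists (mkposreal _ m); intros r hr; change (Rabs (r - s) < d - Rabs (s - a)) in hr.
    replace (r - a) with ((r - s) + (s - a)) by ring.
    pose proof (Rabs_triang (r - s) (s - a)); lra.
  - exists a; replace (a - a) with 0 by ring; rewrite Rabs_R0; auto.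
  - intros r s t hr ht h; apply Rabs_def2 in hr; apply Rabs_def2 in ht.
    apply Rabs_def1; lra.
Qed.

Lemma lipschitz_continuous (f : R -> R) (t : R) :
  (forall s, Rabs (f s - f t) <= Rabs (s - t)) -> continuous f t.
Proof.
  intros h P [e he]; exists e; intros s hs; apply he.
  change (Rabs (s - t) < e) in hs; change (Rabs (f s - f t) < e).
  specialize (h s); lra.
Qed.

(** Nearest-point retraction onto [[a - d, a + d]]. Being 1-Lipschitz and the identity there, it
    turns local data into global data: it is applied to time in [picard] and to the coordinates in
    [integral_curve]. *)
Definition clamp (a d s : R) : R := Rmax (a - d) (Rmin (a + d) s).

Lemma clamp_lipschitz (a d s t : R) : Rabs (clamp a d s - clamp a d t) <= Rabs (s - t).
Proof.
  unfold clamp, Rmax, Rmin, Rabs.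
  repeat destruct Rle_dec; repeat destruct Rcase_abs; lra.
Qed.

Lemma clamp_bound (a d s : R) : 0 <= d -> Rabs (clamp a d s - a) <= d.
Proof.
  intros hd; unfold clamp, Rmax, Rmin, Rabs.
  repeat destruct Rle_dec; repeat destruct Rcase_abs; lra.
Qed.

Lemma clamp_id (a d s : R) : Rabs (s - a) <= d -> clamp a d s = s.
Proof.
  unfold clamp, Rmax, Rmin, Rabs.
  repeat destruct Rle_dec; repeat destruct Rcase_abs; lra.
Qed.

Lemma clamp_continuous (a d t : R) : continuous (clamp a d) t.
Proof. apply lipschitz_continuous; intros s; apply clamp_lipschitz. Qed.

Lemma is_derive_RInt_continuous (f : R -> R) (a t : R) :
  (forall s, continuous f s) -> is_derive (fun b => RInt f a b) t (f t).
Proof.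
  intros cf.
  apply (is_derive_RInt (V := R_NormedModule) f (fun t => RInt f a t) a); auto.
  apply filter_forall; intros b; apply (RInt_correct (V := R_CompleteNormedModule)).
  apply (ex_RInt_continuous (V := R_CompleteNormedModule)); auto.
Qed.

(** The mean value theorem for the difference of the two primitives gives the estimate for both
    signs of [b] at once. *)
Lemma RInt_diff_bound (f g : R -> R) (b K : R) :
  (forall s, continuous f s) -> (forall s, continuous g s) ->
  (forall s, Rabs (f s - g s) <= K) ->
  Rabs (RInt f 0 b - RInt g 0 b) <= Rabs b * K.
Proof.
  intros cf cg hK.
  assert (D : forall x, is_derive (fun b => RInt f 0 b - RInt g 0 b) x (f x - g x)).
  { intros x; apply (is_derive_minus (K := R_AbsRing) (V := R_NormedModule)
      (fun b => RInt f 0 b) (fun b => RInt g 0 b)); apply is_derive_RInt_continuous; auto. }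
  destruct (MVT_gen (fun b => RInt f 0 b - RInt g 0 b) 0 b (fun s => f s - g s))
    as (c & _ & e).
  - auto.
  - intros x _.
    exact (proj2 (continuity_pt_filterlim _ _) (is_derive_continuous _ _ _ (D x))).
  - rewrite !RInt_point in e; unfold zero in e; simpl in e.
    replace (RInt f 0 b - RInt g 0 b) with ((f c - g c) * b) by lra.
    rewrite Rabs_mult, Rmult_comm; apply Rmult_le_compat_l; auto; apply Rabs_pos.
Qed.

Lemma geometric_zero (x K : R) : (forall n : nat, Rabs x <= K * (1 / 2) ^ n) -> x = 0.
Proof.
  intros h; destruct (Req_dec x 0) as [e | n]; auto; exfalso.
  apply Rabs_pos_lt in n.
  assert (hK : 0 < K) by (specialize (h O); simpl in h; lra).
  destruct (pow_lt_1_zero (1 / 2)) with (y := Rabs x / K) as [N hN].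
  - rewrite Rabs_right; lra.
  - apply Rdiv_lt_0_compat; auto.
  - specialize (hN N (le_n N)); specialize (h N).
    rewrite Rabs_right in hN by (apply Rle_ge, pow_le; lra).
    apply (Rmult_lt_compat_l K) in hN; auto.
    replace (K * (Rabs x / K)) with (Rabs x) in hN by (field; lra); lra.
Qed.

(* Clamping the time to [|t| <= h] makes the Picard operator a contraction for
   the sup norm on the whole line. *)
Lemma picard (Y : coord -> R -> R -> R) (p : coord -> R) (M : R) :
  0 < M ->
  (forall k x y x' y', Rabs (Y k x y - Y k x' y') <= M * (Rabs (x - x') + Rabs (y - y'))) ->
  exists (h : R) (c : path), 0 < h /\ (forall k, c k 0 = p k) /\
    forall t, Rabs t < h -> forall k, is_derive (c k) t (Y k (c cx t) (c cy t)).
Proof.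
  (* Two components, each off by at most C, change the integrand by at most [2 M C]; over a time at
     most [h] this integrates to [C / 2], hence the 4. *)
  intros hM lip; set (h := / (4 * M)).
  assert (hh : 0 < h) by (apply Rinv_0_lt_compat; lra).
  assert (hMh : h * M = 1 / 4) by (unfold h; field; lra).
  set (cont := fun u : path => forall k t, continuous (u k) t).
  set (T := fun (u : path) (k : coord) (t : R) =>
    p k + RInt (fun s => Y k (u cx s) (u cy s)) 0 (clamp 0 h t)).
  assert (cY : forall u k t, cont u -> continuous (fun s => Y k (u cx s) (u cy s)) t).
  { intros u k t cu; apply (continuous_comp_2 (u cx) (u cy) (Y k)); auto.
    apply continuity_2d_pt_filterlim; intros eps.
    assert (m : 0 < eps / (2 * M))
      by (apply Rdiv_lt_0_compat; [apply cond_pos | lra]).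
    exists (mkposreal _ m); simpl; intros x y hx hy.
    apply Rle_lt_trans with (1 := lip k x y (u cx t) (u cy t)).
    apply Rlt_le_trans with (M * (eps / (2 * M) + eps / (2 * M))).
    - apply Rmult_lt_compat_l; lra.
    - right; field; lra. }
  assert (cT : forall u, cont u -> cont (T u)).
  { intros u cu k t; unfold T.
    apply (continuous_plus (V := R_NormedModule)); [apply continuous_const|].
    apply continuous_comp with
      (g := fun b => RInt (fun s => Y k (u cx s) (u cy s)) 0 b); [apply clamp_continuous|].
    eapply is_derive_continuous.
    apply (is_derive_RInt_continuous (fun s => Y k (u cx s) (u cy s))); auto. }
  assert (contr : forall u v C, cont u -> cont v -> (forall k t, Rabs (u k t - v k t) <= C) ->
    forall k t, Rabs (T u k t - T v k t) <= C / 2).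
  { intros u v C cu cv hC k t; unfold T.
    assert (C0 : 0 <= C) by (specialize (hC cx 0); pose proof (Rabs_pos (u cx 0 - v cx 0)); lra).
    match goal with |- Rabs (?a + ?b - (?a + ?d)) <= _ =>
      replace (a + b - (a + d)) with (b - d) by ring end.
    eapply Rle_trans;
      [apply (RInt_diff_bound (fun s => Y k (u cx s) (u cy s))
                (fun s => Y k (v cx s) (v cy s)) _ (M * (2 * C)))|]; auto.
    - intros s; eapply Rle_trans; [apply lip|].
      pose proof (hC cx s); pose proof (hC cy s).
      apply Rmult_le_compat_l; lra.
    - pose proof (clamp_bound 0 h t (Rlt_le _ _ hh)) as b; rewrite Rminus_0_r in b.
      apply Rle_trans with (h * (M * (2 * C))).
      + apply Rmult_le_compat_r; auto; apply Rmult_le_pos; lra.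
      + right; replace (h * (M * (2 * C))) with (h * M * (2 * C)) by ring.
        rewrite hMh; field. }
  set (u := fun n : nat => Nat.iter n T (fun k _ => p k)).
  assert (cu : forall n, cont (u n)).
  { induction n as [|n IH]; [intros k t; apply continuous_const | apply cT, IH]. }
  (* A bound for the first Picard step, which starts from the constant path at [p]. *)
  set (C := h * (Rabs (Y cx (p cx) (p cy)) + Rabs (Y cy (p cx) (p cy)))).
  assert (hC : 0 <= C).
  { apply Rmult_le_pos; [lra|].
    pose proof (Rabs_pos (Y cx (p cx) (p cy))).
    pose proof (Rabs_pos (Y cy (p cx) (p cy))); lra. }
  assert (step : forall n k t, Rabs (u (S n) k t - u n k t) <= C * (1 / 2) ^ n).
  { induction n as [|n IH]; intros k t.
    - simpl; unfold T; rewrite RInt_const; unfold scal; simpl; unfold mult; simpl.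
      replace (p k + _ - p k) with ((clamp 0 h t - 0) * Y k (p cx) (p cy)) by ring.
      rewrite Rabs_mult, Rmult_1_r; unfold C.
      apply Rmult_le_compat; try apply Rabs_pos; [apply clamp_bound; lra|].
      pose proof (Rabs_pos (Y cx (p cx) (p cy))).
      pose proof (Rabs_pos (Y cy (p cx) (p cy))); destruct k; lra.
    - replace (C * (1 / 2) ^ S n) with (C * (1 / 2) ^ n / 2) by (simpl; field).
      apply (contr (u (S n)) (u n)); auto. }
  (* The factor [1 - (1 / 2) ^ m] is that of the exact partial geometric sum, which lets the
     induction on m close; [tail'] then drops it. *)
  assert (tail : forall n m k t, Rabs (u (m + n)%nat k t - u n k t) <=
                                 2 * C * (1 / 2) ^ n * (1 - (1 / 2) ^ m)).
  { intros n m k t; induction m as [|m IH].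
    - simpl; rewrite Rminus_diag, Rabs_R0, Rminus_diag; lra.
    - replace (u (S m + n)%nat k t - u n k t) with
        ((u (S (m + n)) k t - u (m + n)%nat k t) + (u (m + n)%nat k t - u n k t))
        by (simpl; ring).
      eapply Rle_trans; [apply Rabs_triang|].
      eapply Rle_trans; [apply Rplus_le_compat; [apply step | apply IH]|].
      right; rewrite pow_add; simpl; field. }
  assert (tail' : forall n m k t, (n <= m)%nat ->
    Rabs (u m k t - u n k t) <= 2 * C * (1 / 2) ^ n).
  { intros n m k t nm; replace m with (m - n + n)%nat by lia.
    eapply Rle_trans; [apply tail|].
    assert (0 <= (1 / 2) ^ (m - n)) by (apply pow_le; lra).
    rewrite <- (Rmult_1_r (2 * C * (1 / 2) ^ n)) at 2.
    apply Rmult_le_compat_l; [|lra].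
    apply Rmult_le_pos; [lra | apply pow_le; lra]. }
  assert (small : forall e, 0 < e -> exists N, 2 * C * (1 / 2) ^ N < e).
  { intros e he; destruct (pow_lt_1_zero (1 / 2)) with (y := e / (2 * C + 1)) as [N hN].
    - rewrite Rabs_right; lra.
    - apply Rdiv_lt_0_compat; lra.
    - exists N; specialize (hN N (le_n N)).
      rewrite Rabs_right in hN by (apply Rle_ge, pow_le; lra).
      apply (Rmult_lt_compat_l (2 * C + 1)) in hN; [|lra].
      replace ((2 * C + 1) * (e / (2 * C + 1))) with e in hN by (field; lra).
      assert (0 <= (1 / 2) ^ N) by (apply pow_le; lra); nra. }
  assert (lim : forall k t, { l : R | is_lim_seq (fun n => u n k t) l }).
  { intros k t; exists (real (Lim_seq (fun n => u n k t))).
    apply Lim_seq_correct', ex_lim_seq_cauchy_corr; intros eps.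
    destruct (small (eps / 2)) as [N hN]; [pose proof (cond_pos eps); lra|].
    exists N; intros n m hn hm.
    pose proof (tail' N n k t hn); pose proof (tail' N m k t hm).
    replace (u n k t - u m k t) with ((u n k t - u N k t) - (u m k t - u N k t)) by ring.
    eapply Rle_lt_trans; [apply Rabs_triang|]; rewrite Rabs_Ropp; lra. }
  set (c := (fun k t => proj1_sig (lim k t)) : path).
  assert (hc : forall n k t, Rabs (c k t - u n k t) <= 2 * C * (1 / 2) ^ n).
  { intros n k t; unfold c; destruct (lim k t) as [l hl]; simpl.
    apply (is_lim_seq_le_loc (fun m => Rabs (u m k t - u n k t))
             (fun _ => 2 * C * (1 / 2) ^ n) (Rabs (l - u n k t)) (2 * C * (1 / 2) ^ n)).
    - exists n; intros m hm; apply tail'; auto.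
    - apply (is_lim_seq_abs _ (Finite (l - u n k t))).
      apply is_lim_seq_minus'; [exact hl | apply is_lim_seq_const].
    - apply is_lim_seq_const. }
  (* Uniform limit of continuous functions, by thirds of epsilon. *)
  assert (cc : cont c).
  { intros k t P [e he].
    destruct (small (e / 3)) as [N hN]; [pose proof (cond_pos e); lra|].
    assert (m : 0 < e / 3) by (pose proof (cond_pos e); lra).
    destruct (cu N k t _ (locally_ball _ (mkposreal _ m))) as [e' he'].
    exists e'; intros s hs; apply he' in hs; change (Rabs (u N k s - u N k t) < e / 3) in hs.
    apply he; change (Rabs (c k s - c k t) < e).
    pose proof (hc N k s) as h1; pose proof (hc N k t) as h2.
    replace (c k s - c k t) with
      ((c k s - u N k s) + (u N k s - u N k t) - (c k t - u N k t)) by ring.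
    eapply Rle_lt_trans; [apply Rabs_triang|]; rewrite Rabs_Ropp.
    eapply Rle_lt_trans; [apply Rplus_le_compat_r, Rabs_triang|]; lra. }
  (* Both [c - u (S n)] and [T c - T (u n)] are at most [C (1/2)^n], for every n. *)
  assert (fixed : forall k t, c k t = T c k t).
  { intros k t; apply Rminus_diag_uniq, geometric_zero with (2 * C); intros n.
    pose proof (hc (S n) k t) as h1.
    pose proof (contr c (u n) (2 * C * (1 / 2) ^ n) cc (cu n) (hc n) k t) as h2.
    replace (c k t - T c k t) with ((c k t - u (S n) k t) - (T c k t - T (u n) k t))
      by (simpl; ring).
    eapply Rle_trans; [apply Rabs_triang|]; rewrite Rabs_Ropp.
    replace (2 * C * (1 / 2) ^ S n) with (C * (1 / 2) ^ n) in h1 by (simpl; field).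
    simpl in h1 |- *; lra. }
  exists h, c; split; [auto|]; split.
  - intros k; rewrite fixed; unfold T; rewrite clamp_id by (rewrite Rminus_0_r, Rabs_R0; lra).
    rewrite RInt_point; unfold zero; simpl; ring.
  - intros t ht k.
    apply is_derive_ext_loc with (fun t => p k + RInt (fun s => Y k (c cx s) (c cy s)) 0 t).
    + destruct (open_interval_ball 0 h hh) as [o _].
      assert (ht' : Rabs (t - 0) < h) by (rewrite Rminus_0_r; auto).
      apply filter_imp with (2 := o t ht'); intros s hs.
      rewrite fixed; unfold T; rewrite clamp_id; auto; lra.
    + replace (Y k (c cx t) (c cy t)) with (0 + Y k (c cx t) (c cy t)) by ring.
      apply (is_derive_plus (K := R_AbsRing) (V := R_NormedModule)).
      * apply is_derive_Reals, derivable_pt_lim_const.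
      * apply (is_derive_RInt_continuous (fun s => Y k (c cx s) (c cy s))); auto.
Qed.

Lemma continuity_2d_pt_bounded (f : R -> R -> R) (x y : R) :
  continuity_2d_pt f x y -> locally_2d (fun u v => Rabs (f u v) <= Rabs (f x y) + 1) x y.
Proof.
  intros cf; destruct (cf (mkposreal 1 Rlt_0_1)) as [d hd]; exists d; intros u v hu hv.
  specialize (hd u v hu hv); simpl in hd.
  pose proof (Rabs_triang (f u v - f x y) (f x y)).
  replace (f u v - f x y + f x y) with (f u v) in H by ring; lra.
Qed.

(** Clamping the coordinates to a small box around [p] makes the field globally Lipschitz, as
    [picard] requires. For short times continuity keeps the curve in the box, where clamping does
    nothing and the original equation holds. *)
Lemma integral_curve (U : R * R -> Prop) (X : vfield) (p : coord -> R) :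
  open U -> (forall k, smooth U (X k)) -> U (p cx, p cy) ->
  exists (h : R) (c : path), 0 < h /\ (forall k, c k 0 = p k) /\
    forall t, Rabs (t - 0) < h -> U (c cx t, c cy t) /\
      forall k, is_derive (c k) t (X k (c cx t) (c cy t)).
Proof.
  intros oU sX hp.
  assert (bd : exists M, 0 < M /\ exists d, 0 < d /\ forall x y,
    Rabs (x - p cx) < d -> Rabs (y - p cy) < d ->
    U (x, y) /\ forall i k, Rabs (pd i (X k) x y) <= M).
  (* Near [p] each partial derivative exceeds its value at [p] by less than one in absolute value;
     the sum of the four bounds serves for all of them. *)
  { set (B := fun i k => Rabs (pd i (X k) (p cx) (p cy)) + 1).
    assert (Bpos : forall i k, 0 < B i k)
      by (intros i k; unfold B; pose proof (Rabs_pos (pd i (X k) (p cx) (p cy))); lra).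
    exists (B cx cx + B cx cy + (B cy cx + B cy cy)); split;
      [apply Rplus_lt_0_compat; apply Rplus_lt_0_compat; auto|].
    assert (L : forall i k, locally_2d (fun x y => Rabs (pd i (X k) x y) <= B i k) (p cx) (p cy)).
    { intros i k; apply continuity_2d_pt_bounded, smooth_continuity with U; auto.
      apply smooth_pd; auto. }
    destruct (open_locally_2d U _ _ oU hp) as [d0 h0].
    destruct (locally_2d_and _ _ _ _ (locally_2d_and _ _ _ _ (L cx cx) (L cx cy))
                (locally_2d_and _ _ _ _ (L cy cx) (L cy cy))) as [d1 h1].
    exists (Rmin d0 d1); split; [apply Rmin_pos; [apply (cond_pos d0) | apply (cond_pos d1)]|].
    intros x y hx hy; pose proof (Rmin_l d0 d1); pose proof (Rmin_r d0 d1).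
    split; [apply h0; lra|].
    pose proof (Bpos cx cx); pose proof (Bpos cx cy).
    pose proof (Bpos cy cx); pose proof (Bpos cy cy).
    assert (hB := h1 x y ltac:(lra) ltac:(lra)).
    destruct hB as [[? ?] [? ?]].
    intros [|] [|]; lra. }
  destruct bd as (M & hM & d & hd & bd).
  (* Half the radius keeps clamped points strictly inside the box where the bounds hold. *)
  set (cl := fun k => clamp (p k) (d / 2)).
  assert (hcl : forall k s, Rabs (cl k s - p k) < d)
    by (intros k s; pose proof (clamp_bound (p k) (d / 2) s); unfold cl; lra).
  destruct (picard (fun k x y => X k (cl cx x) (cl cy y)) p M hM) as (h & c & hh & c0 & dc).
  { intros k x y x' y'.
    (* The increment is split at the corner [(x', y)], so that one coordinate moves at a time. *)
    destruct (MVT_interval (fun s => Rabs (s - p cx) < d) (fun s => X k s (cl cy y))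
      (fun s => pd cx (X k) s (cl cy y)) (cl cx x') (cl cx x)) as (a & ha & _ & ea); auto.
    { apply open_interval_ball; auto. }
    { intros t ht; apply (smooth_derive_x U); auto; apply bd; auto. }
    destruct (MVT_interval (fun s => Rabs (s - p cy) < d) (fun s => X k (cl cx x') s)
      (fun s => pd cy (X k) (cl cx x') s) (cl cy y') (cl cy y)) as (b & hb & _ & eb); auto.
    { apply open_interval_ball; auto. }
    { intros t ht; apply (smooth_derive_y U); auto; apply bd; auto. }
    replace (X k (cl cx x) (cl cy y) - X k (cl cx x') (cl cy y')) with
      (pd cx (X k) a (cl cy y) * (cl cx x - cl cx x') +
       pd cy (X k) (cl cx x') b * (cl cy y - cl cy y')) by lra.
    eapply Rle_trans; [apply Rabs_triang|].
    rewrite Rmult_plus_distr_l, !Rabs_mult.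
    apply Rplus_le_compat; apply Rmult_le_compat; try apply Rabs_pos;
      try apply clamp_lipschitz; apply bd; auto. }
  assert (near : forall k, exists e : posreal,
            forall t, Rabs (t - 0) < e -> Rabs (c k t - p k) < d / 2).
  { intros k.
    assert (m : 0 < d / 2) by lra.
    destruct (is_derive_continuous (c k) 0 _ (dc 0 ltac:(rewrite Rabs_R0; auto) k)
                _ (locally_ball _ (mkposreal _ m))) as [e he].
    exists e; intros t ht; rewrite <- (c0 k); exact (he t ht). }
  destruct (near cx) as [ex hx], (near cy) as [ey hy].
  exists (Rmin h (Rmin ex ey)), c; split.
  { repeat apply Rmin_pos; [auto | apply (cond_pos ex) | apply (cond_pos ey)]. }
  split; auto; intros t ht.
  pose proof (Rmin_l h (Rmin ex ey)); pose proof (Rmin_r h (Rmin ex ey)).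
  pose proof (Rmin_l ex ey); pose proof (Rmin_r ex ey).
  specialize (hx t ltac:(lra)); specialize (hy t ltac:(lra)).
  split; [apply bd; lra|].
  intros k; rewrite Rminus_0_r in ht.
  pose proof (dc t ltac:(lra) k) as D; simpl in D; unfold cl in D.
  rewrite !clamp_id in D by lra; exact D.
Qed.

(** * Leaves *)

Definition eval (w : form) (X : coord -> R) : scalar :=
  fun x y => sum2 (fun k => w k x y * X k).

Definition quad (T : tensor) (X : coord -> R) : scalar :=
  fun x y => sum2 (fun i => sum2 (fun j => T i j x y * X i * X j)).

(** The covector turned by a right angle: it spans [ker w] wherever [w] is nonzero and is smooth in
    the point. The factor [-1] is a product to suit [sa_mult]. *)
Definition kernel_vector (w : form) (x y : R) (k : coord) : R :=
  match k with cx => -1 * w cy x y | cy => w cx x y end.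

Definition wedge (u v : coord -> R) : R := u cx * v cy - u cy * v cx.

(** The leaf is an integral curve of the kernel field. The velocity at time 0 is recorded because
    cubic forms are compared there. *)
Lemma leaf_exists (U : R * R -> Prop) (w : form) (x y : R) :
  open U -> smooth_form U w -> nonvanishing U w -> U (x, y) ->
  exists (I : R -> Prop) (c : path), leaf_curve U w I c /\ I 0 /\
    c cx 0 = x /\ c cy 0 = y /\ forall k, Derive (c k) 0 = kernel_vector w x y k.
Proof.
  intros oU sw nw hU.
  set (X := (fun k x y => kernel_vector w x y k) : vfield).
  assert (sX : forall k, smooth U (X k)).
  { intros [|]; [|apply sw].
    apply smooth_algebra_smooth, (sa_mult U (fun _ _ => -1) (w cy)); auto;
      [apply sa_const | apply sa_base, sw]. }
  destruct (integral_curve U X (fun k => match k with cx => x | cy => y end) oU sX hU)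
    as (h & c & hh & c0 & hc).
  set (I := fun t => Rabs (t - 0) < h).
  assert (OI : open_interval I) by (apply open_interval_ball; auto).
  destruct (OI) as (oI & _ & _).
  assert (d : forall t, I t -> forall k, Derive (c k) t = X k (c cx t) (c cy t))
    by (intros t ht k; apply is_derive_unique, hc; auto).
  assert (i0 : I 0) by (unfold I; rewrite Rminus_0_r, Rabs_R0; auto).
  (* The equation [c' = X(c)] with [X] smooth gains one derivative at each round. *)
  assert (dc : forall n k, diff_n I n (c k)).
  { induction n as [|n IH]; intros k; [easy|].
    apply diff_n_intro with (fun t => X k (c cx t) (c cy t)); auto.
    - intros t ht; apply hc; auto.
    - apply diff_n_chain with U; auto; intros t ht; apply hc; auto. }
  exists I, c; split; [split|].
  - split; [auto|]; split; [|split].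
    + intros k; apply smooth_on_diff_n; auto.
    + intros t ht; apply hc; auto.
    + intros t ht; destruct (hc t ht) as [hUt _]; destruct (nw _ _ hUt) as [[|] n].
      * exists cy; rewrite d by auto; exact n.
      * exists cx; rewrite d by auto; unfold X; simpl; lra.
  - intros t ht; unfold sum2; rewrite !d by auto; unfold X; simpl; ring.
  - split; [auto|]; split; [exact (c0 cx)|]; split; [exact (c0 cy)|].
    intros k; rewrite d by auto; rewrite (c0 cx), (c0 cy); reflexivity.
Qed.

(* Differentiating [w(c') = 0] along the leaf gives
   [w(c'' + G(c',c')) + (sym_diff G w)(c',c') = 0]. *)
Lemma leaf_geodesic (U : R * R -> Prop) (G : connection) (w : form)
    (I : R -> Prop) (c : path) :
  open U -> (forall k i j, smooth U (G k i j)) -> smooth_form U w -> nonvanishing U w ->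
  (forall x y X, U (x, y) -> eval w X x y = 0 -> quad (sym_diff G w) X x y = 0) ->
  leaf_curve U w I c -> geodesic U G I c.
Proof.
  intros oU sG sw nw hker [rc hl].
  apply geodesic_iff; auto; split; auto; intros t ht.
  destruct rc as ((oI & _) & sc & hU & _).
  assert (dc : forall k, diff_n I 2 (c k)) by (intros k; apply smooth_on_diff_n; auto).
  assert (d1 : forall k, is_derive (c k) t (Derive (c k) t))
    by (intros k; eapply diff_n_is_derive; eauto).
  assert (d2 : forall k, is_derive (Derive (c k)) t (Derive_n (c k) 2 t))
    by (intros k; apply (diff_n_is_derive I 0 (Derive (c k)) t); [apply (dc k) | auto]).
  assert (dw : forall k, is_derive (fun s => w k (c cx s) (c cy s)) t
     (pd cx (w k) (c cx t) (c cy t) * Derive (c cx) t +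
      pd cy (w k) (c cx t) (c cy t) * Derive (c cy) t))
    by (intros k; apply (smooth_chain U); auto).
  assert (dp : forall k, is_derive (fun s => w k (c cx s) (c cy s) * Derive (c k) s) t
     ((pd cx (w k) (c cx t) (c cy t) * Derive (c cx) t +
       pd cy (w k) (c cx t) (c cy t) * Derive (c cy) t) * Derive (c k) t +
      w k (c cx t) (c cy t) * Derive_n (c k) 2 t)).
  { intros k; apply (is_derive_mult (K := R_AbsRing)
      (fun s => w k (c cx s) (c cy s)) (Derive (c k))); auto; apply Rmult_comm. }
  assert (ds := is_derive_plus (K := R_AbsRing) (V := R_NormedModule) _ _ _ _ _ (dp cx) (dp cy)).
  assert (dz : is_derive (fun s : R => sum2 (fun k => w k (c cx s) (c cy s) * Derive (c k) s)) t 0).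
  { apply is_derive_ext_loc with (fun _ => 0).
    - apply filter_imp with (2 := oI t ht); intros s hs; symmetry; apply hl; auto.
    - apply is_derive_Reals, derivable_pt_lim_const. }
  apply is_derive_unique in ds; apply is_derive_unique in dz.
  assert (E := eq_trans (eq_sym ds) dz); clear ds dz dp dw d1 d2.
  specialize (hl t ht); specialize (hU t ht).
  pose proof (hker _ _ (fun k => Derive (c k) t) hU hl) as hq.
  destruct (nw _ _ hU) as [i hi].
  change (acceleration G c cx t) with
    (Derive_n (c cx) 2 t + quad (G cx) (fun k => Derive (c k) t) (c cx t) (c cy t)).
  change (acceleration G c cy t) with
    (Derive_n (c cy) 2 t + quad (G cy) (fun k => Derive (c k) t) (c cx t) (c cy t)).
  unfold quad, sym_diff, cov_diff, plus, sum2 in *; simpl in E.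
  cbv beta in hq.
  set (vx := Derive (c cx) t) in *; set (vy := Derive (c cy) t) in *.
  change (Derive_n (c cx) 2 t) with (Derive (Derive (c cx)) t) in *.
  change (Derive_n (c cy) 2 t) with (Derive (Derive (c cy)) t) in *.
  set (ax := Derive (Derive (c cx)) t) in *; set (ay := Derive (Derive (c cy)) t) in *.
  set (x := c cx t) in *; set (y := c cy t) in *.
  match goal with |- ?a * _ = ?b * _ => set (Ax := a); set (Ay := b) end.
  (* [E] is the differentiated equation [w(c') = 0] and [hq] the assumption on [ker w]; their
     difference is [w] applied to the covariant acceleration. *)
  assert (K : w cx x y * Ax + w cy x y * Ay = 0).
  { unfold Ax, Ay; simpl in hq.
    match type of E with ?l = 0 => match type of hq with ?m = 0 =>
      transitivity (l - m); [field | rewrite E, hq; ring] end end. }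
  (* Velocity and acceleration are both killed by the nonzero covector [w], hence parallel; the case
     is which component of [w] is nonzero. *)
  destruct i.
  - apply Rmult_eq_reg_l with (w cx x y); auto.
    transitivity ((w cx x y * Ax + w cy x y * Ay) * vy - Ay * (w cx x y * vx + w cy x y * vy)
      + w cx x y * (Ay * vx)); [ring | rewrite K, hl; ring].
  - apply Rmult_eq_reg_l with (w cy x y); auto.
    transitivity (Ax * (w cx x y * vx + w cy x y * vy) - (w cx x y * Ax + w cy x y * Ay) * vx
      + w cy x y * (Ay * vx)); [ring | rewrite K, hl; ring].
Qed.

(** * Projective equivalence *)

(* The cubic form whose vanishing on [X] says that [G(X,X)] is parallel to [X];
   the projective class of [G] determines it and is determined by it. *)
Definition cubic (G : connection) (X : coord -> R) : scalar :=
  fun x y => wedge (fun k => quad (G k) X x y) X.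

(** The wedge of acceleration and velocity is [c''] wedge [c'] plus the cubic form at [c']. The
    first term is the same for [G] and [H] and cancels. *)
Lemma geodesic_cubic_iff (U : R * R -> Prop) (G H : connection) (I : R -> Prop) (c : path) :
  open U -> (forall k i j, smooth U (G k i j)) -> (forall k i j, smooth U (H k i j)) ->
  geodesic U G I c ->
  geodesic U H I c <-> forall t, I t ->
    cubic G (fun k => Derive (c k) t) (c cx t) (c cy t) =
    cubic H (fun k => Derive (c k) t) (c cx t) (c cy t).
Proof.
  intros oU sG sH hG; rewrite geodesic_iff in * by auto; destruct hG as [rc hG].
  assert (E : forall K t, acceleration K c cx t * Derive (c cy) t -
      acceleration K c cy t * Derive (c cx) t =
      Derive_n (c cx) 2 t * Derive (c cy) t - Derive_n (c cy) 2 t * Derive (c cx) t +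
      cubic K (fun k => Derive (c k) t) (c cx t) (c cy t)).
  { intros K t; unfold cubic, wedge, quad, acceleration; ring. }
  split.
  - intros [_ hH] t ht; specialize (hG t ht); specialize (hH t ht).
    pose proof (E G t); pose proof (E H t); lra.
  - intros e; split; auto; intros t ht; specialize (hG t ht); specialize (e t ht).
    pose proof (E G t); pose proof (E H t); lra.
Qed.

Lemma projectively_equivalent_cubic (U : R * R -> Prop) (G H : connection) :
  open U -> (forall k i j, smooth U (G k i j)) -> (forall k i j, smooth U (H k i j)) ->
  (forall x y X, U (x, y) -> cubic G X x y = cubic H X x y) ->
  projectively_equivalent U G H.
Proof.
  intros oU sG sH e I c; split; intros hg; assert (hU := proj1 hg);
    destruct hU as (_ & _ & hU & _).
  - apply (geodesic_cubic_iff U G H); auto.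
  - apply (geodesic_cubic_iff U H G); auto; intros t ht; symmetry; auto.
Qed.

Lemma geodesic_web_cubic (U : R * R -> Prop) (G H : connection) (W : web) (w : form)
    (x y : R) :
  open U -> (forall k i j, smooth U (G k i j)) -> (forall k i j, smooth U (H k i j)) ->
  geodesic_web U G W -> geodesic_web U H W -> In w W ->
  smooth_form U w -> nonvanishing U w -> U (x, y) ->
  cubic G (kernel_vector w x y) x y = cubic H (kernel_vector w x y) x y.
Proof.
  intros oU sG sH gG gH hw sw nw hU.
  destruct (leaf_exists U w x y oU sw nw hU) as (I & c & hl & i0 & ex & ey & dv).
  pose proof (proj1 (geodesic_cubic_iff U G H I c oU sG sH (gG w hw I c hl)) (gH w hw I c hl) 0 i0)
    as e.
  rewrite ex, ey in e.
  replace (fun k => Derive (c k) 0) with (kernel_vector w x y) in e; auto.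
  apply functional_extensionality; intros k; symmetry; apply dv.
Qed.

(** * Binary cubic forms and uniqueness of the projective structure *)

(** In the basis [u1], [u2] the pure cubes drop out, so the form is a product of the two coordinates
    and a linear form with coefficients [p], [q]. That linear form vanishes at the independent
    vectors [u3], [u4], hence is zero. *)
Lemma binary_cubic_zero (a b c d : R) (u1 u2 u3 u4 : coord -> R) :
  let K := fun v : coord -> R =>
    a * v cx ^ 3 + b * v cx ^ 2 * v cy + c * v cx * v cy ^ 2 + d * v cy ^ 3 in
  wedge u1 u2 <> 0 -> wedge u1 u3 <> 0 -> wedge u1 u4 <> 0 ->
  wedge u2 u3 <> 0 -> wedge u2 u4 <> 0 -> wedge u3 u4 <> 0 ->
  K u1 = 0 -> K u2 = 0 -> K u3 = 0 -> K u4 = 0 -> forall v, K v = 0.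
Proof.
  intros K n12 n13 n14 n23 n24 n34 k1 k2 k3 k4 v.
  (* Polarization: [p] is the derivative of [K] at [u1] along [u2], and [q] the derivative at [u2]
     along [u1]. *)
  set (p := 3 * a * u1 cx ^ 2 * u2 cx + b * (2 * u1 cx * u1 cy * u2 cx + u1 cx ^ 2 * u2 cy) +
    c * (u1 cy ^ 2 * u2 cx + 2 * u1 cx * u1 cy * u2 cy) + 3 * d * u1 cy ^ 2 * u2 cy).
  set (q := 3 * a * u2 cx ^ 2 * u1 cx + b * (2 * u2 cx * u2 cy * u1 cx + u2 cx ^ 2 * u1 cy) +
    c * (u2 cy ^ 2 * u1 cx + 2 * u2 cx * u2 cy * u1 cy) + 3 * d * u2 cy ^ 2 * u1 cy).
  (* [wedge u1 u2 * v = wedge v u2 * u1 + wedge u1 v * u2] *)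
  assert (E : forall v, wedge u1 u2 ^ 3 * K v =
    wedge v u2 * wedge u1 v * (wedge v u2 * p + wedge u1 v * q)).
  { intros r.
    transitivity (wedge r u2 ^ 3 * K u1 + wedge u1 r ^ 3 * K u2 +
      wedge r u2 * wedge u1 r * (wedge r u2 * p + wedge u1 r * q)).
    - unfold K, p, q, wedge; ring.
    - rewrite k1, k2; ring. }
  assert (z : forall r, wedge u1 r <> 0 -> wedge u2 r <> 0 -> K r = 0 ->
    wedge r u2 * p + wedge u1 r * q = 0).
  { intros r n1 n2 kr; specialize (E r); rewrite kr, Rmult_0_r in E; symmetry in E.
    apply Rmult_integral in E; destruct E as [E | E]; auto.
    apply Rmult_integral in E; destruct E as [E | E]; [|easy].
    exfalso; apply n2; unfold wedge in *; lra. }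
  pose proof (z u3 n13 n23 k3) as z3; pose proof (z u4 n14 n24 k4) as z4.
  (* By the Plücker relation this product is the determinant of the linear system [z3], [z4] in [p],
     [q]. *)
  assert (nd : wedge u1 u2 * wedge u3 u4 <> 0)
    by (apply Rmult_integral_contrapositive; auto).
  assert (p0 : p = 0).
  { apply Rmult_eq_reg_l with (wedge u1 u2 * wedge u3 u4); auto; rewrite Rmult_0_r.
    transitivity (wedge u1 u4 * (wedge u3 u2 * p + wedge u1 u3 * q) -
      wedge u1 u3 * (wedge u4 u2 * p + wedge u1 u4 * q)).
    - unfold wedge; ring.
    - rewrite z3, z4; ring. }
  assert (q0 : q = 0).
  { apply Rmult_eq_reg_l with (wedge u1 u2 * wedge u3 u4); auto; rewrite Rmult_0_r.
    transitivity (wedge u3 u2 * (wedge u4 u2 * p + wedge u1 u4 * q) -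
      wedge u4 u2 * (wedge u3 u2 * p + wedge u1 u3 * q)).
    - unfold wedge; ring.
    - rewrite z3, z4; ring. }
  apply Rmult_eq_reg_l with (wedge u1 u2 ^ 3); [|apply pow_nonzero; auto].
  rewrite E, p0, q0; ring.
Qed.

(** The cubic form is linear in the Christoffel symbols, so the difference of two of them is again a
    binary cubic form, with coefficients read off from [D]. *)
Lemma cubic_zero (G H : connection) (x y : R) (u1 u2 u3 u4 : coord -> R) :
  wedge u1 u2 <> 0 -> wedge u1 u3 <> 0 -> wedge u1 u4 <> 0 ->
  wedge u2 u3 <> 0 -> wedge u2 u4 <> 0 -> wedge u3 u4 <> 0 ->
  (forall u, In u [u1; u2; u3; u4] -> cubic G u x y = cubic H u x y) ->
  forall v, cubic G v x y = cubic H v x y.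
Proof.
  intros n12 n13 n14 n23 n24 n34 e v.
  set (D := fun k i j => G k i j x y - H k i j x y).
  assert (E : forall v, cubic G v x y - cubic H v x y =
    (- D cy cx cx) * v cx ^ 3 + (D cx cx cx - D cy cx cy - D cy cy cx) * v cx ^ 2 * v cy +
    (D cx cx cy + D cx cy cx - D cy cy cy) * v cx * v cy ^ 2 + D cx cy cy * v cy ^ 3).
  { intros r; unfold cubic, wedge, quad, sum2, D; ring. }
  assert (e' : forall u, In u [u1; u2; u3; u4] -> cubic G u x y - cubic H u x y = 0)
    by (intros u hu; rewrite e by auto; ring).
  apply Rminus_diag_uniq; rewrite E.
  apply (binary_cubic_zero _ _ _ _ u1 u2 u3 u4); auto; rewrite <- E; apply e'; simpl; auto.
Qed.

(** Were the wedge zero, the kernel vector of [u] would be killed by [v] too, hence vanish, and [u]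
    with it. *)
Lemma distinct_directions_wedge (U : R * R -> Prop) (u v : form) (x y : R) :
  nonvanishing U u -> distinct_directions U u v -> U (x, y) ->
  wedge (kernel_vector u x y) (kernel_vector v x y) <> 0.
Proof.
  intros nu duv hU e; unfold wedge in e; simpl in e.
  assert (z := duv x y hU (kernel_vector u x y)); unfold sum2 in z; simpl in z.
  specialize (z ltac:(ring) ltac:(lra)).
  destruct (nu x y hU) as [[|] n]; [apply n, (z cy) | apply n; specialize (z cx); simpl in z; lra].
Qed.

Lemma geodesic_web_unique (U : R * R -> Prop) (G H : connection) (w1 w2 w3 w4 : form) :
  open U -> planar_web U [w1; w2; w3; w4] ->
  (forall k i j, smooth U (G k i j)) -> (forall k i j, smooth U (H k i j)) ->
  geodesic_web U G [w1; w2; w3; w4] -> geodesic_web U H [w1; w2; w3; w4] ->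
  projectively_equivalent U G H.
Proof.
  intros oU (sW & nW & dW) sG sH gG gH.
  apply projectively_equivalent_cubic; auto; intros x y X hU.
  rewrite Forall_forall in sW, nW.
  assert (dd : forall u v, In u [w1; w2; w3; w4] -> distinct_directions U u v ->
    wedge (kernel_vector u x y) (kernel_vector v x y) <> 0)
    by (intros u v hu d; eapply distinct_directions_wedge; eauto).
  inversion_clear dW as [|? ? f1 dW1]; inversion_clear dW1 as [|? ? f2 dW2].
  inversion_clear dW2 as [|? ? f3 dW3].
  rewrite Forall_forall in f1, f2, f3.
  apply (cubic_zero G H x y (kernel_vector w1 x y) (kernel_vector w2 x y)
           (kernel_vector w3 x y) (kernel_vector w4 x y));
    try (apply dd; [simpl; auto | (apply f1 || apply f2 || apply f3); simpl; auto; fail]).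
  intros u hu.
  assert (exists w, In w [w1; w2; w3; w4] /\ u = kernel_vector w x y) as (w & hw & ->).
  { simpl in hu; destruct hu as [<- | [<- | [<- | [<- | []]]]]; eexists; split;
      try reflexivity; simpl; auto. }
  apply geodesic_web_cubic with U [w1; w2; w3; w4]; auto.
Qed.

(** Uniqueness is stated with equality of predicates, so equivalence of connections has to be turned
    into equality of classes by extensionality. *)
Lemma projective_class_eq (U : R * R -> Prop) (G H : connection) :
  projectively_equivalent U G H -> projective_class U G = projective_class U H.
Proof.
  intros e; apply functional_extensionality; intros K; apply propositional_extensionality.
  split; intros [t p]; split; auto; intros I c; rewrite (p I c), (e I c); tauto.
Qed.

(** * The canonical connection *)

Lemma sa_minus (U : R * R -> Prop) (f g : scalar) :
  smooth_algebra U f -> smooth_algebra U g -> smooth_algebra U (fun x y => f x y - g x y).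
Proof.
  intros sf sg; apply sa_ext with (fun x y => f x y + (fun x y => -1 * g x y) x y).
  - apply sa_plus; auto; apply sa_mult; auto; apply sa_const.
  - intros x y _; ring.
Qed.

Lemma sa_div (U : R * R -> Prop) (f g : scalar) :
  smooth_algebra U f -> smooth_algebra U g -> (forall x y, U (x, y) -> g x y <> 0) ->
  smooth_algebra U (fun x y => f x y / g x y).
Proof. intros sf sg nz; apply sa_mult; auto; apply sa_inv; auto. Qed.

Definition det (u v : form) : scalar :=
  fun x y => u cx x y * v cy x y - u cy x y * v cx x y.

(* By Cramer's rule, the solution of [sym_diff G u = S], [sym_diff G v = T]. *)
Definition connection_of (u v : form) (S T : tensor) : connection :=
  fun k i j x y =>
    let A := (pd i (u j) x y + pd j (u i) x y) / 2 - S i j x y in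
    let B := (pd i (v j) x y + pd j (v i) x y) / 2 - T i j x y in
    match k with
    | cx => A * v cy x y - B * u cy x y
    | cy => B * u cx x y - A * v cx x y
    end / det u v x y.

Lemma connection_of_smooth (U : R * R -> Prop) (u v : form) (S T : tensor) (k i j : coord) :
  open U -> smooth_form U u -> smooth_form U v ->
  (forall x y, U (x, y) -> det u v x y <> 0) ->
  (forall i j, smooth_algebra U (S i j)) -> (forall i j, smooth_algebra U (T i j)) ->
  smooth U (connection_of u v S T k i j).
Proof.
  intros oU su sv nz sS sT; apply smooth_algebra_smooth; auto.
  assert (bu : forall k, smooth_algebra U (u k)) by (intros; apply sa_base, su).
  assert (bv : forall k, smooth_algebra U (v k)) by (intros; apply sa_base, sv).
  assert (du : forall i k, smooth_algebra U (pd i (u k)))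
    by (intros; apply sa_base, smooth_pd, su).
  assert (dv : forall i k, smooth_algebra U (pd i (v k)))
    by (intros; apply sa_base, smooth_pd, sv).
  assert (sd : smooth_algebra U (det u v)) by (apply sa_minus; apply sa_mult; auto).
  assert (half : forall f, smooth_algebra U f -> smooth_algebra U (fun x y => f x y / 2)).
  { intros f sf; apply (sa_div U f (fun _ _ => 2)); [auto | apply sa_const | intros; lra]. }
  assert (sA : smooth_algebra U
    (fun x y => (pd i (u j) x y + pd j (u i) x y) / 2 - S i j x y)).
  { apply sa_minus; auto; apply (half (fun x y => pd i (u j) x y + pd j (u i) x y)).
    apply sa_plus; auto. }
  assert (sB : smooth_algebra U
    (fun x y => (pd i (v j) x y + pd j (v i) x y) / 2 - T i j x y)).
  { apply sa_minus; auto; apply (half (fun x y => pd i (v j) x y + pd j (v i) x y)).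
    apply sa_plus; auto. }
  destruct k.
  - exact (sa_div U _ _ (sa_minus U _ _ (sa_mult U _ _ sA (bv cy)) (sa_mult U _ _ sB (bu cy))) sd nz).
  - exact (sa_div U _ _ (sa_minus U _ _ (sa_mult U _ _ sB (bu cx)) (sa_mult U _ _ sA (bv cx))) sd nz).
Qed.

Lemma connection_of_sym_diff (U : R * R -> Prop) (u v : form) (S T : tensor) :
  (forall x y, U (x, y) -> det u v x y <> 0) ->
  (forall i j x y, S i j x y = S j i x y) -> (forall i j x y, T i j x y = T j i x y) ->
  tensor_eq_on U (sym_diff (connection_of u v S T) u) S /\
  tensor_eq_on U (sym_diff (connection_of u v S T) v) T.
Proof.
  intros nz sS sT; split; intros i j x y hU; specialize (nz x y hU);
    unfold sym_diff, cov_diff, sum2, connection_of;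
    rewrite (sS j i), (sT j i); unfold det in *; field; auto.
Qed.

(** Without torsion the symbols are symmetric in [i], [j]. For each such pair the two differentials
    then give a linear system for the difference of the symbols, with determinant [det u v]. *)
Lemma torsion_free_sym_diff_unique (U : R * R -> Prop) (G H : connection) (u v : form) :
  torsion_free_connection U G -> torsion_free_connection U H ->
  (forall x y, U (x, y) -> det u v x y <> 0) ->
  tensor_eq_on U (sym_diff G u) (sym_diff H u) ->
  tensor_eq_on U (sym_diff G v) (sym_diff H v) ->
  connection_eq_on U G H.
Proof.
  intros [_ tG] [_ tH] nz eu ev k i j x y hU.
  specialize (nz x y hU); specialize (eu i j x y hU); specialize (ev i j x y hU).
  pose proof (tG cx i j x y hU); pose proof (tG cy i j x y hU).
  pose proof (tH cx i j x y hU); pose proof (tH cy i j x y hU).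
  unfold torsion, sym_diff, cov_diff, sum2 in *.
  replace (G cx j i x y) with (G cx i j x y) in * by lra.
  replace (G cy j i x y) with (G cy i j x y) in * by lra.
  replace (H cx j i x y) with (H cx i j x y) in * by lra.
  replace (H cy j i x y) with (H cy i j x y) in * by lra.
  assert (Eu : (G cx i j x y - H cx i j x y) * u cx x y +
               (G cy i j x y - H cy i j x y) * u cy x y = 0) by lra.
  assert (Ev : (G cx i j x y - H cx i j x y) * v cx x y +
               (G cy i j x y - H cy i j x y) * v cy x y = 0) by lra.
  apply Rminus_diag_uniq, Rmult_eq_reg_l with (det u v x y); auto.
  rewrite Rmult_0_r; unfold det; destruct k.
  - transitivity (v cy x y * ((G cx i j x y - H cx i j x y) * u cx x y +
               (G cy i j x y - H cy i j x y) * u cy x y) -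
      u cy x y * ((G cx i j x y - H cx i j x y) * v cx x y +
               (G cy i j x y - H cy i j x y) * v cy x y)); [ring|].
    rewrite Eu, Ev; ring.
  - transitivity (u cx x y * ((G cx i j x y - H cx i j x y) * v cx x y +
               (G cy i j x y - H cy i j x y) * v cy x y) -
      v cx x y * ((G cx i j x y - H cx i j x y) * u cx x y +
               (G cy i j x y - H cy i j x y) * u cy x y)); [ring|].
    rewrite Eu, Ev; ring.
Qed.

Lemma pd_eq_on (U : R * R -> Prop) (f g : scalar) (i : coord) (x y : R) :
  open U -> (forall x y, U (x, y) -> f x y = g x y) -> U (x, y) -> pd i f x y = pd i g x y.
Proof.
  intros oU e hU.
  assert (L : locally_2d (fun u v => f u v = g u v) x y).
  { apply locally_2d_impl with (2 := open_locally_2d U x y oU hU).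
    apply locally_2d_forall; auto. }
  destruct i; apply Derive_ext_loc;
    [exact (locally_2d_1d_const_y _ x y L) | exact (locally_2d_1d_const_x _ x y L)].
Qed.

(* Leibniz rule for [d^s], read on the diagonal. *)
Lemma quad_sym_diff_combination (U : R * R -> Prop) (G : connection) (a : scalar)
    (u v w : form) (X : coord -> R) (x y : R) :
  open U -> smooth U a -> smooth_form U u -> smooth_form U v ->
  (forall k x y, U (x, y) -> a x y * u k x y + v k x y + w k x y = 0) -> U (x, y) ->
  quad (sym_diff G w) X x y =
    - (sum2 (fun i => pd i a x y * X i) * eval u X x y +
       a x y * quad (sym_diff G u) X x y + quad (sym_diff G v) X x y).
Proof.
  intros oU sa su sv e hU.
  assert (W : forall k x y, U (x, y) -> w k x y = -1 * (a x y * u k x y + v k x y))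
    by (intros k s t h; specialize (e k s t h); lra).
  assert (E : forall i j, pd i (w j) x y =
    - (pd i a x y * u j x y + a x y * pd i (u j) x y + pd i (v j) x y)).
  { intros i j; rewrite (pd_eq_on U _ _ i x y oU (W j) hU).
    replace (- _) with
      (-1 * (pd i a x y * u j x y + a x y * pd i (u j) x y + pd i (v j) x y)) by ring.
    destruct i; apply is_derive_unique, is_derive_scal;
      apply (is_derive_plus (K := R_AbsRing) (V := R_NormedModule)).
    - apply (is_derive_mult (K := R_AbsRing) (fun t => a t y) (fun t => u j t y));
        [eapply smooth_derive_x; eauto | eapply smooth_derive_x; eauto | apply Rmult_comm].
    - eapply smooth_derive_x; eauto.
    - apply (is_derive_mult (K := R_AbsRing) (fun t => a x t) (fun t => u j x t));
        [eapply smooth_derive_y; eauto | eapply smooth_derive_y; eauto | apply Rmult_comm].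
    - eapply smooth_derive_y; eauto. }
  unfold quad, sym_diff, cov_diff, eval, sum2.
  rewrite !E, !(W _ x y hU); field.
Qed.

(** * Dual frames and the geodesic web *)

Lemma dual_frame_det (U : R * R -> Prop) (u v : form) (e f : vfield) (x y : R) :
  dual_frame U u v e f -> U (x, y) -> det u v x y <> 0.
Proof.
  intros h hU; destruct (h x y hU) as (h1 & h2 & h3 & h4); unfold pairing, sum2 in *; intros z.
  assert (E : det u v x y * (e cx x y * f cy x y - e cy x y * f cx x y) = 1).
  { transitivity ((u cx x y * e cx x y + u cy x y * e cy x y) *
                  (v cx x y * f cx x y + v cy x y * f cy x y) -
                  (u cx x y * f cx x y + u cy x y * f cy x y) *
                  (v cx x y * e cx x y + v cy x y * e cy x y)); [unfold det; ring|].
    rewrite h1, h2, h3, h4; ring. }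
  rewrite z in E; lra.
Qed.

Lemma dual_frame_cramer (U : R * R -> Prop) (u v : form) (e f : vfield) (x y : R) :
  dual_frame U u v e f -> U (x, y) ->
  e cx x y = v cy x y / det u v x y /\ e cy x y = - v cx x y / det u v x y /\
  f cx x y = - u cy x y / det u v x y /\ f cy x y = u cx x y / det u v x y.
Proof.
  intros h hU; pose proof (dual_frame_det U u v e f x y h hU) as nz.
  destruct (h x y hU) as (h1 & h2 & h3 & h4); unfold pairing, sum2 in *.
  repeat split; apply Rmult_eq_reg_l with (det u v x y); auto;
    match goal with |- _ = ?d * (?n / ?d) =>
      replace (d * (n / d)) with n by (field; auto) end; unfold det.
  - transitivity (v cy x y * (u cx x y * e cx x y + u cy x y * e cy x y) -
      u cy x y * (v cx x y * e cx x y + v cy x y * e cy x y)); [ring | rewrite h1, h3; ring].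
  - transitivity (u cx x y * (v cx x y * e cx x y + v cy x y * e cy x y) -
      v cx x y * (u cx x y * e cx x y + u cy x y * e cy x y)); [ring | rewrite h1, h3; ring].
  - transitivity (v cy x y * (u cx x y * f cx x y + u cy x y * f cy x y) -
      u cy x y * (v cx x y * f cx x y + v cy x y * f cy x y)); [ring | rewrite h2, h4; ring].
  - transitivity (u cx x y * (v cx x y * f cx x y + v cy x y * f cy x y) -
      v cx x y * (u cx x y * f cx x y + u cy x y * f cy x y)); [ring | rewrite h2, h4; ring].
Qed.

(** [dual_frame] prescribes only values; smoothness of the frame is recovered from the quotients of
    Cramer's rule. *)
Lemma dual_frame_smooth (U : R * R -> Prop) (u v : form) (e f : vfield) (k : coord) :
  dual_frame U u v e f -> smooth_form U u -> smooth_form U v ->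
  smooth_algebra U (e k) /\ smooth_algebra U (f k).
Proof.
  intros h su sv.
  assert (bu : forall k, smooth_algebra U (u k)) by (intros; apply sa_base, su).
  assert (bv : forall k, smooth_algebra U (v k)) by (intros; apply sa_base, sv).
  assert (sd : smooth_algebra U (det u v)) by (apply sa_minus; apply sa_mult; auto).
  assert (nz : forall x y, U (x, y) -> det u v x y <> 0)
    by (intros x y; eapply dual_frame_det; eauto).
  assert (q : forall (w g : scalar) (r : R), smooth_algebra U w ->
    (forall x y, U (x, y) -> g x y = r * w x y / det u v x y) -> smooth_algebra U g).
  { intros w g r sw e'; apply sa_ext with (fun x y => r * w x y / det u v x y);
      [|intros; symmetry; auto].
    apply (sa_div U (fun x y => r * w x y) (det u v)); auto.
    apply (sa_mult U (fun _ _ => r)); auto; apply sa_const. }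
  assert (C := fun x y hU => dual_frame_cramer U u v e f x y h hU).
  destruct k; split;
    [apply (q (v cy) _ 1) | apply (q (u cy) _ (-1)) | apply (q (v cx) _ (-1))
    | apply (q (u cx) _ 1)]; auto; intros x y hU;
    destruct (C x y hU) as (C1 & C2 & C3 & C4);
    [rewrite C1 | rewrite C3 | rewrite C2 | rewrite C4]; field; auto.
Qed.

(** The identity [da = a1 w1 + a2 w2], evaluated on [X]; it brings [a1] and [a2] into [d^s w4]. *)
Lemma dual_frame_expansion (U : R * R -> Prop) (u v : form) (e f : vfield)
    (a : scalar) (X : coord -> R) (x y : R) :
  dual_frame U u v e f -> U (x, y) ->
  sum2 (fun i => pd i a x y * X i) =
    eval u X x y * lie e a x y + eval v X x y * lie f a x y.
Proof.
  intros h hU; destruct (dual_frame_cramer U u v e f x y h hU) as (C1 & C2 & C3 & C4).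
  pose proof (dual_frame_det U u v e f x y h hU) as nz.
  unfold lie, eval, sum2; rewrite C1, C2, C3, C4; unfold det in *; field; auto.
Qed.

Lemma quad_scale_sym_prod (f : scalar) (u v : form) (X : coord -> R) (x y : R) :
  quad (scale f (sym_prod u v)) X x y = f x y * eval u X x y * eval v X x y.
Proof. unfold quad, scale, sym_prod, eval, sum2; field. Qed.

Lemma quad_eq_on (U : R * R -> Prop) (S T : tensor) (X : coord -> R) (x y : R) :
  tensor_eq_on U S T -> U (x, y) -> quad S X x y = quad T X x y.
Proof. intros e hU; unfold quad, sum2; rewrite !(fun i j => e i j x y hU); ring. Qed.

(* The factor [z] is what makes the fourth foliation geodesic: on [ker w4], where
   [w2 = - a w1] and [w3 = (a - 1) w1], the form [(d^s w4)(X, X)] equals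
   [- (a1 - a a2 - a (1 - a) z) (w1 X)^2]. *)
Lemma canonical_web_geodesic (U : R * R -> Prop) (G : connection) (w1 w2 w3 w4 : form)
    (a z : scalar) (e1 e2 : vfield) :
  open U -> (forall k i j, smooth U (G k i j)) ->
  planar_web U [w1; w2; w3; w4] -> smooth U a ->
  (forall k x y, U (x, y) -> w1 k x y + w2 k x y + w3 k x y = 0) ->
  (forall k x y, U (x, y) -> a x y * w1 k x y + w2 k x y + w4 k x y = 0) ->
  dual_frame U w1 w2 e1 e2 ->
  (forall x y, U (x, y) ->
     z x y * (a x y * (1 - a x y)) = lie e1 a x y - a x y * lie e2 a x y) ->
  tensor_eq_on U (sym_diff G w1) (scale (fun x y => z x y / 2) (sym_prod w3 w1)) ->
  tensor_eq_on U (sym_diff G w2) (scale (fun x y => - (z x y / 2)) (sym_prod w3 w2)) ->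
  geodesic_web U G [w1; w2; w3; w4].
Proof.
  intros oU sG (sW & nW & _) sa h3 h4 hd hz S1 S2 w hw I c hl.
  rewrite Forall_forall in sW, nW.
  apply leaf_geodesic with w; auto; intros x y X hU hX.
  assert (Q1 : quad (sym_diff G w1) X x y = z x y / 2 * eval w3 X x y * eval w1 X x y)
    by (rewrite (quad_eq_on U _ _ X x y S1 hU), quad_scale_sym_prod; auto).
  assert (Q2 : quad (sym_diff G w2) X x y = - (z x y / 2) * eval w3 X x y * eval w2 X x y)
    by (rewrite (quad_eq_on U _ _ X x y S2 hU), quad_scale_sym_prod; auto).
  assert (s1 : smooth_form U w1) by (apply sW; simpl; auto).
  assert (s2 : smooth_form U w2) by (apply sW; simpl; auto).
  assert (E3 : eval w3 X x y = - (eval w1 X x y + eval w2 X x y)).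
  { pose proof (h3 cx x y hU) as hx; pose proof (h3 cy x y hU) as hy; unfold eval, sum2.
    replace (w3 cx x y) with (- (w1 cx x y + w2 cx x y)) by lra.
    replace (w3 cy x y) with (- (w1 cy x y + w2 cy x y)) by lra; ring. }
  simpl in hw; destruct hw as [<- | [<- | [<- | [<- | []]]]].
  - rewrite Q1, hX; ring.
  - rewrite Q2, hX; ring.
  (* The third form is handled as the fourth with the constant 1 in place of [a]; every remaining
     term contains the factor [eval w3 X], which is zero here. *)
  - assert (sone : smooth U (fun _ _ => 1))
      by (apply smooth_algebra_smooth; auto; apply sa_const).
    rewrite (quad_sym_diff_combination U G (fun _ _ => 1) w1 w2 w3 X x y); auto.
    + replace (sum2 (fun i => pd i (fun _ _ => 1) x y * X i)) with 0
        by (unfold sum2, pd; rewrite !Derive_const; ring).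
      rewrite Q1, Q2, hX; ring.
    + intros k s t h; rewrite Rmult_1_l; auto.
  - rewrite (quad_sym_diff_combination U G a w1 w2 w4 X x y); auto.
    rewrite (dual_frame_expansion U w1 w2 e1 e2 a X x y hd hU), Q1, Q2, E3.
    assert (E2 : eval w2 X x y = - a x y * eval w1 X x y).
    { revert hX; pose proof (h4 cx x y hU) as hx; pose proof (h4 cy x y hU) as hy.
      unfold eval, sum2.
      replace (w4 cx x y) with (- (a x y * w1 cx x y + w2 cx x y)) by lra.
      replace (w4 cy x y) with (- (a x y * w1 cy x y + w2 cy x y)) by lra; lra. }
    rewrite E2; specialize (hz x y hU).
    transitivity (eval w1 X x y ^ 2 *
      (z x y * (a x y * (1 - a x y)) - (lie e1 a x y - a x y * lie e2 a x y)));
      [field | rewrite hz; ring].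
Qed.

Theorem theorem7 (U : R * R -> Prop) (w1 w2 w3 w4 : form) (a : scalar)
    (e1 e2 : vfield)
    (hU : plane_domain U)
    (hweb : planar_web U [w1; w2; w3; w4])
    (ha : smooth U a)
    (ha01 : forall x y, U (x, y) -> a x y <> 0 /\ a x y <> 1)
    (h3 : forall k x y, U (x, y) -> w1 k x y + w2 k x y + w3 k x y = 0)
    (h4 : forall k x y, U (x, y) -> a x y * w1 k x y + w2 k x y + w4 k x y = 0)
    (hclosed : closed_form U w3)
    (hdual : dual_frame U w1 w2 e1 e2) :
  let z : scalar := fun x y =>
    (lie e1 a x y - a x y * lie e2 a x y) / (a x y * (1 - a x y)) in
  let canonical (nabla : connection) : Prop :=
    torsion_free_connection U nabla /\
    tensor_eq_on U (sym_diff nabla w1)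
      (scale (fun x y => z x y / 2) (sym_prod w3 w1)) /\
    tensor_eq_on U (sym_diff nabla w2)
      (scale (fun x y => - (z x y / 2)) (sym_prod w3 w2)) in
  (exists! P : connection -> Prop,
     projective_structure U P /\ geodesic_web_for U P [w1; w2; w3; w4]) /\
  (exists nabla : connection,
     canonical nabla /\
     (forall nabla', canonical nabla' -> connection_eq_on U nabla' nabla) /\
     geodesic_web_for U (projective_class U nabla) [w1; w2; w3; w4]).
Proof.
  intros z canonical; destruct hU as [oU _].
  assert (sW : forall w, In w [w1; w2; w3; w4] -> smooth_form U w)
    by (destruct hweb as [sW _]; rewrite Forall_forall in sW; auto).
  assert (s1 : smooth_form U w1) by (apply sW; simpl; auto).
  assert (s2 : smooth_form U w2) by (apply sW; simpl; auto).
  assert (s3 : smooth_form U w3) by (apply sW; simpl; auto).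
  assert (nz : forall x y, U (x, y) -> det w1 w2 x y <> 0)
    by (intros x y; eapply dual_frame_det; eauto).
  assert (nza : forall x y, U (x, y) -> a x y * (1 - a x y) <> 0).
  { intros x y h; destruct (ha01 x y h) as [n0 n1].
    apply Rmult_integral_contrapositive; split; auto; lra. }
  assert (bz : smooth_algebra U (fun x y => z x y / 2)).
  { assert (se := fun k => dual_frame_smooth U w1 w2 e1 e2 k hdual s1 s2).
    assert (l1 : smooth_algebra U (lie e1 a)) by
      (apply (sa_plus U (fun x y => e1 cx x y * pd cx a x y) (fun x y => e1 cy x y * pd cy a x y));
        apply sa_mult; try apply se; apply sa_base, smooth_pd; auto).
    assert (l2 : smooth_algebra U (lie e2 a)) by
      (apply (sa_plus U (fun x y => e2 cx x y * pd cx a x y) (fun x y => e2 cy x y * pd cy a x y));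
        apply sa_mult; try apply se; apply sa_base, smooth_pd; auto).
    assert (sa := sa_base U a ha).
    apply (sa_div U z (fun _ _ => 2)); [|apply sa_const | intros; lra].
    exact (sa_div U _ _ (sa_minus U _ _ l1 (sa_mult U _ _ sa l2))
             (sa_mult U _ _ sa (sa_minus U _ _ (sa_const U 1) sa)) nza). }
  assert (bS : forall f w, smooth_algebra U f -> smooth_form U w ->
            forall i j, smooth_algebra U (scale f (sym_prod w3 w) i j)).
  { intros f w sf sw i j.
    apply (sa_mult U f (fun x y => (w3 i x y * w j x y + w3 j x y * w i x y) / 2)); auto.
    apply (sa_div U (fun x y => w3 i x y * w j x y + w3 j x y * w i x y) (fun _ _ => 2));
      [|apply sa_const | intros; lra].
    apply (sa_plus U (fun x y => w3 i x y * w j x y) (fun x y => w3 j x y * w i x y));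
      apply sa_mult; apply sa_base; auto. }
  set (S1 := scale (fun x y => z x y / 2) (sym_prod w3 w1)).
  set (S2 := scale (fun x y => - (z x y / 2)) (sym_prod w3 w2)).
  set (nabla := connection_of w1 w2 S1 S2).
  assert (symS : forall f u v i j x y,
            scale f (sym_prod u v) i j x y = scale f (sym_prod u v) j i x y)
    by (intros; unfold scale, sym_prod; f_equal; f_equal; ring).
  assert (tf : torsion_free_connection U nabla).
  { split.
    - intros k i j; apply connection_of_smooth; auto; intros i' j'; apply bS; auto.
      apply sa_ext with (fun x y => 0 - z x y / 2); [|intros; ring].
      apply (sa_minus U (fun _ _ => 0)); auto; apply sa_const.
    - intros k i j x y h; unfold torsion, nabla, connection_of.
      unfold S1, S2; rewrite (symS _ _ _ j i), (symS _ _ _ j i).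
      rewrite (Rplus_comm (pd j (w1 i) x y)), (Rplus_comm (pd j (w2 i) x y)); ring. }
  assert (can : canonical nabla).
  { split; [exact tf|]; apply connection_of_sym_diff; auto; apply symS. }
  assert (gw : geodesic_web_for U (projective_class U nabla) [w1; w2; w3; w4]).
  (* All members of the class have the geodesics of [nabla], so only [nabla] is tested on the
     leaves. *)
  { intros H [tH eH] w hw I c hl; apply eH.
    destruct can as (_ & c1 & c2).
    apply (canonical_web_geodesic U nabla w1 w2 w3 w4 a z e1 e2) with w; auto; [apply tf|].
    intros x y h; specialize (nza x y h); unfold z; field.
    split; intros e; apply nza; rewrite e; ring. }
  split.
  - exists (projective_class U nabla); split.
    + split; auto; exists nabla; auto.
    (* One representative of each structure suffices: [nabla] and [H] lie in their own classes, so
       both make the web geodesic and are therefore equivalent. *)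
    + intros P [(H & tH & ->) gP]; apply projective_class_eq.
      apply geodesic_web_unique with w1 w2 w3 w4; auto; try apply tf; try apply tH.
      * apply gw; split; auto; intros I c; tauto.
      * apply gP; split; auto; intros I c; tauto.
  - exists nabla; split; [auto|]; split; auto.
    intros nabla' (t' & c1 & c2); destruct can as (_ & d1 & d2).
    apply torsion_free_sym_diff_unique with w1 w2; auto; intros i j x y h;
      [rewrite (c1 i j x y h), (d1 i j x y h) | rewrite (c2 i j x y h), (d2 i j x y h)]; auto.
Qed.
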